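(* For every $q_0 \in [0,1)$ there exists $\beta = \beta(q_0) \in (0,1)$ with the following property. If $E \subset \mathbb{R}$ is a Borel set with $\dim_H(E) > \beta$, then there exist $0 < a_0 < a_1$ such that for all $q \in [-q_0, q_0]$, $$[-a_1, -a_0] \cup [a_0, a_1] \subset \Delta_q(E).$$
   Context: $\dim_H$ denotes Hausdorff dimension. For $E \subset \mathbb{R}$ and $q \in \mathbb{R}$, the 3-point configuration set is $$\Delta_q(E) := \left\{ \frac{(z-x) - q(y-x)}{(y-x)^2} \;:\; x,y,z \in E,\ x \neq y,\ x \neq z \right\}.$$ *)

(* Defs.v *)
From HB Require Import structures.
From mathcomp Require Export all_boot all_order all_algebra.
From mathcomp Require Export all_classical all_reals all_analysis.
Export Order.TTheory GRing.Theory Num.Theory.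
Export numFieldNormedType.Exports.

Set Implicit Arguments.
Unset Strict Implicit.
Unset Printing Implicit Defensive.

Local Open Scope classical_set_scope.
Local Open Scope ring_scope.

(* diam set0 = -oo rather than 0: harmless below, since set0 is still allowed in
   every delta-cover and gets its weight separately. *)
Definition diam {R : realType} (A : set R) : \bar R :=
  ereal_sup [set `|p.1 - p.2|%:E | p in A `*` A].

(* The empty set has weight 0 for every s, so that a finite cover can be padded
   into a sequence. Elsewhere (diam U)^s is used with the library convention
   0 `^ 0 = 1, hence the measure obtained for s = 0 is the counting measure. *)
Definition hausdorff_weight {R : realType} (s : R) (U : set R) : \bar R :=
  if U == set0 then 0%E else (diam U `^ s)%E.

Definition delta_cover {R : realType} (delta : R) (A : set R)
    (U : nat -> set R) : Prop :=
  A `<=` \bigcup_i U i /\ forall i, (diam (U i) <= delta%:E)%E.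

Definition hausdorff_premeasure {R : realType} (delta s : R) (A : set R) :
    \bar R :=
  ereal_inf [set (\sum_(i <oo) hausdorff_weight s (U i))%E |
             U in delta_cover delta A].

Definition hausdorff_measure {R : realType} (s : R) (A : set R) : \bar R :=
  ereal_sup [set hausdorff_premeasure delta s A | delta in [set d : R | 0 < d]].

Definition hausdorff_dim {R : realType} (A : set R) : \bar R :=
  ereal_inf [set s%:E | s in [set s : R | 0 <= s /\ hausdorff_measure s A = 0%E]].

Definition config_set {R : realType} (q : R) (E : set R) : set R :=
  [set t | exists x y z, [/\ E x, E y & E z] /\ [/\ x != y, x != z &
     t = ((z - x) - q * (y - x)) / (y - x) ^+ 2]].

(* Main.v *)
(** Write [phi x y = x + q (y - x) + t (y - x)^2]; one looks for [x], [y] and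
    [phi x y] in [E]. If [dim E] is close to 1, then [E] has almost full dyadic
    content in some dyadic cell; after rescaling that cell to [0, 1), [t] ranges
    over [5, 51/10]. A Frostman measure gives densities [f_k] at the scales
    [2^-k], at least [1/8] at some initial scale and at most a constant times
    [2^(k (1 - beta))], and it suffices that the averages of
    [f_k(x) f_k(y) f_k(phi x y)] stay bounded below.

    The point is a smoothing estimate: if [D] oscillates at scale [e], the
    average of [f0(x) f1(y) D(phi x y)] is at most a power of [e] for bounded [f0]
    and [f1]. By Cauchy-Schwarz in [x] and in [y] it is controlled by the average
    of [D(phi x y) D(phi x y') D(phi x' y) D(phi x' y')]; since the family of
    curves [phi = const] is curved, [x, x', y, y'] can be moved so that the
    first three arguments stay fixed while the last one moves at unit speed, and
    [D] cancels along this motion. As [beta] tends to 1 the growth of [f_k]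
    is negligible against this gain.

    The limit [k -> oo] is taken along closed sets decreasing into [E], which
    exist because Borel sets are Suslin sets and dyadic content is continuous
    along increasing sequences of sets. *)

Require Import Defs.
From mathcomp Require Import ring lra zify.

Set Implicit Arguments.
Unset Strict Implicit.
Unset Printing Implicit Defensive.

Local Open Scope ring_scope.

(** * Finite sums *)

Section FiniteSums.
Context {R : realFieldType}.
Implicit Types (m n v : nat).

(** No limit measure is formed: at each level the Frostman measure is a finite list of atoms on a
    closed set, the averages are sums over a grid finer than the scale of every density involved,
    and compactness is applied only to the points that are found. The order of the choices matters.
    The starting scale 2^(-48 [m0]) comes from the constants of the smoothing estimate alone; then
    [tau] is taken so small that the density at that scale is at least 1/8; [beta] comes last.
    Scales advance by 48 at a time: each of the three densities may then grow by g^48, while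
    smoothing gains a factor 1/2, so g^144 <= 9/8 leaves a geometric series of ratio 9/16. Negative
    values of the configuration are obtained by reflecting the cell, z -> 1 - z, which changes the
    sign of the value. *)

Lemma sum_CauchySchwarz (I : finType) (a b : I -> R) :
  (\sum_i a i * b i) ^+ 2 <= (\sum_i a i ^+ 2) * (\sum_i b i ^+ 2).
Proof.
have : 0 <= \sum_i \sum_j (a i * b j - a j * b i) ^+ 2.
  by apply: sumr_ge0 => i _; apply: sumr_ge0 => j _; exact: sqr_ge0.
have -> : \sum_i \sum_j (a i * b j - a j * b i) ^+ 2 =
   ((\sum_i a i ^+ 2) * (\sum_i b i ^+ 2) - (\sum_i a i * b i) ^+ 2) *+ 2.
  pose T i j := a i ^+ 2 * b j ^+ 2 - (a i * b i) * (a j * b j).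
  have -> : (\sum_i a i ^+ 2) * (\sum_i b i ^+ 2) - (\sum_i a i * b i) ^+ 2 =
      \sum_i \sum_j T i j.
    rewrite expr2 !mulr_suml -sumrB; apply: eq_bigr => i _.
    by rewrite !mulr_sumr -sumrB; apply: eq_bigr => j _.
  rewrite mulr2n [X in _ = _ + X]exchange_big /= -big_split /=; apply: eq_bigr => i _.
  by rewrite -big_split /=; apply: eq_bigr => j _; rewrite /T; ring.
by rewrite pmulrn_lge0 // subr_ge0.
Qed.

Lemma sum_bounded_sqr (I : finType) (a b : I -> R) (M : R) :
  (forall i, `|a i| <= M) ->
  (\sum_i a i * b i) ^+ 2 <= #|I|%:R * M ^+ 2 * \sum_i b i ^+ 2.
Proof.
move=> aM; apply: (le_trans (sum_CauchySchwarz a b)).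
apply: ler_wpM2r; first by apply: sumr_ge0 => i _; exact: sqr_ge0.
apply: (@le_trans _ _ (\sum_(i : I) M ^+ 2)).
  apply: ler_sum => i _; rewrite -real_normK ?num_real //.
  by rewrite lerXn2r ?nnegrE //; apply: (le_trans (normr_ge0 _) (aM i)).
by rewrite sumr_const mulr_natl.
Qed.

(* Two applications of Cauchy-Schwarz, one in each variable. *)
Lemma box_CauchySchwarz (I J : finType) (f : I -> R) (g : J -> R)
    (F : I -> J -> R) (M : R) :
  (forall i, `|f i| <= M) -> (forall j, `|g j| <= M) ->
  (\sum_i \sum_j f i * g j * F i j) ^+ 4 <=
  (#|I|%:R * #|J|%:R) ^+ 2 * M ^+ 8 *
  \sum_i \sum_i' \sum_j \sum_j' F i j * F i j' * F i' j * F i' j'.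
Proof.
move=> fM gM; pose A i := \sum_j g j * F i j.
pose B (p : J * J) := \sum_i F i p.1 * F i p.2.
have -> : \sum_i \sum_j f i * g j * F i j = \sum_i f i * A i.
  apply: eq_bigr => i _; rewrite mulr_sumr; apply: eq_bigr => j _; ring.
have A2 : \sum_i A i ^+ 2 = \sum_p (g p.1 * g p.2) * B p.
  rewrite -(pair_bigA _ (fun j j' => (g j * g j') * B (j, j'))) /=.
  rewrite (eq_bigr (fun i => \sum_j \sum_j' (g j * F i j) * (g j' * F i j'))); last first.
    move=> i _; rewrite expr2 mulr_suml; apply: eq_bigr => j _.
    by rewrite mulr_sumr.
  rewrite exchange_big /=; apply: eq_bigr => j _.
  rewrite exchange_big /=; apply: eq_bigr => j' _.
  by rewrite mulr_sumr; apply: eq_bigr => i _ /=; ring.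
have B2 : \sum_p B p ^+ 2 =
    \sum_i \sum_i' \sum_j \sum_j' F i j * F i j' * F i' j * F i' j'.
  rewrite -(pair_bigA _ (fun j j' => B (j, j') ^+ 2)) /=.
  rewrite (eq_bigr (fun j => \sum_i \sum_i' \sum_j' F i j * F i j' * F i' j * F i' j')).
    by rewrite exchange_big; apply: eq_bigr => i _; rewrite exchange_big.
  move=> j _; rewrite (eq_bigr (fun j' => \sum_i \sum_i' F i j * F i j' * F i' j * F i' j')).
    by rewrite exchange_big; apply: eq_bigr => i _; rewrite exchange_big.
  move=> j' _; rewrite /B expr2 mulr_suml; apply: eq_bigr => i _.
  by rewrite mulr_sumr; apply: eq_bigr => i' _ /=; ring.
have S2 := @sum_bounded_sqr _ f A M fM.
have T2 : (\sum_i A i ^+ 2) ^+ 2 <= #|{: J * J}|%:R * (M ^+ 2) ^+ 2 * \sum_p B p ^+ 2.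
  rewrite A2; apply: sum_bounded_sqr => p.
  by rewrite normrM expr2 ler_pM.
rewrite -B2 (exprM _ 2 2).
apply: (@le_trans _ _ ((#|I|%:R * M ^+ 2 * \sum_i A i ^+ 2) ^+ 2)).
  rewrite lerXn2r // nnegrE ?sqr_ge0 // (le_trans _ S2) // ?sqr_ge0 //.
rewrite exprMn.
apply: (le_trans (ler_wpM2l (sqr_ge0 _) T2)).
rewrite card_prod natrM le_eqVlt; apply/orP; left; apply/eqP; ring.
Qed.

(** The sum telescopes: each further translation by one step changes it only by two end terms. *)
Lemma sum_shift (h : int -> R) (B : R) (J : nat) (v : int) :
  (forall i, `|h i| <= B) ->
  `|\sum_(i < J) (h (i%:Z + v) - h i%:Z)| <= 2 * `|v|%:~R * B.
Proof.
have nat_case (k : int -> R) (n : nat) : (forall i, `|k i| <= B) ->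
    `|\sum_(i < J) (k (i%:Z + n%:Z) - k i%:Z)| <= 2 * n%:R * B.
  move=> kB; elim: n => [|n IH].
    rewrite mulr0 mul0r big1 ?normr0 // => i _; by rewrite addr0 subrr.
  rewrite (eq_bigr (fun i : 'I_J => (k (i%:Z + n%:Z) - k i%:Z) +
      (k (i.+1%:Z + n%:Z) - k (i%:Z + n%:Z)))); last first.
    move=> i _; rewrite (_ : i%:Z + n.+1%:Z = i.+1%:Z + n%:Z); [ring | lia].
  rewrite big_split /=.
  have -> : \sum_(i < J) (k (i.+1%:Z + n%:Z) - k (i%:Z + n%:Z)) =
      k (J%:Z + n%:Z) - k (0 + n%:Z).
    elim: (J) => [|J' IHJ]; first by rewrite big_ord0 subrr.
    by rewrite big_ord_recr /= IHJ; ring.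
  apply: (le_trans (ler_normD _ _)); rewrite -(natr1 n).
  apply: (le_trans (lerD IH (ler_normB _ _))).
  have := kB (J%:Z + n%:Z); have := kB (0 + n%:Z); lra.
move=> hB; case: v => n; first exact: nat_case.
rewrite NegzE; have := @nat_case (fun z => h (z - n.+1%:Z)) n.+1 (fun i => hB _).
rewrite -normrN -sumrN; under eq_bigr do rewrite addrK opprB.
by rewrite normrN.
Qed.

Lemma big_ord_mul (A J : nat) (g : nat -> R) :
  \sum_(i < A * J) g i = \sum_(a < A) \sum_(b < J) g (a * J + b)%N.
Proof.
elim: A => [|A IH]; first by rewrite mul0n !big_ord0.
rewrite big_ord_recr /= -IH -!(big_mkord xpredT g) mulSn addnC.
rewrite (@big_cat_nat _ _ _ (A * J)%N) //= ?leq_addr //; congr (_ + _).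
by rewrite -{1}[(A * J)%N]add0n big_addn addKn big_mkord; apply: eq_bigr => i _; rewrite addnC.
Qed.

Lemma sum_near_diagonal (A D : nat) :
  \sum_(b < A) \sum_(b' < A) (`|b%:Z - b'%:Z|%N < D)%N%:R <= A%:R * (2 * D%:R) :> R.
Proof.
apply: (@le_trans _ _ (\sum_(b < A) (2 * D%:R))); last first.
  by rewrite sumr_const card_ord -[_ *+ A]mulr_natl.
apply: ler_sum => b _; rewrite -natr_sum -natrM ler_nat.
(* A neighbour [b'] of [b] goes to [b' + D - b], strictly between 0 and [2 * D]; as 0 is missed, at
   most [2 * D] of the [(2 * D).+1] values are taken. *)
pose F := fun b' : 'I_A => inord (b' + D - b) : 'I_(2 * D).+1.
have -> : (\sum_(b' < A) (`|b%:Z - b'%:Z| < D)%N)%N = #|[set b' : 'I_A | (`|b%:Z - b'%:Z| <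
    D)%N]|%N.
  by rewrite -sum1dep_card [RHS]big_mkcond /=; apply: eq_bigr => i _; case: ifP.
rewrite -(@card_in_imset _ _ F); last first.
  move=> i j; rewrite !inE => hi hj /(congr1 val) /=.
  rewrite !inordK; [|lia|lia] => e; apply: val_inj => /=; lia.
apply: (@leq_trans #|~: [set (ord0 : 'I_(2 * D).+1)]|); last first.
  by rewrite cardsC1 card_ord.
apply: subset_leq_card; apply/fintype.subsetP => y /imsetP[i]; rewrite !inE => hi ->.
rewrite -val_eqE /= inordK; lia.
Qed.

End FiniteSums.

(** * The local geometry of the pattern *)

Section Geometry.
Context {R : realFieldType}.

Definition phi (q t x y : R) : R := x + q * (y - x) + t * (y - x) ^+ 2.

Definition slope (q t x y : R) : R := q + 2 * t * (y - x).

Definition admissible (q t : R) : Prop := -1 <= q <= 1 /\ 5 <= t <= 51 / 10.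

(** In these windows [y - x] is close to 1/4 and [2 * t * (y - x)] close to 5/2: large enough for
    the slope to exceed 1 whenever [q] is in [-1, 1], small enough for [phi] to stay in (0, 1). The
    common length 1/64 suits dyadic grids. *)
Definition left_window (x : R) : Prop := 1 / 8 <= x <= 9 / 64.
Definition right_window (y : R) : Prop := 3 / 8 <= y <= 25 / 64.

(* The slopes stay away from 0, 1/2 and 1, the values at which the family of
   curves [phi = const] is degenerate. *)
Lemma slope_bounds (q t x y : R) : admissible q t -> left_window x -> right_window y ->
  13 / 10 <= slope q t x y <= 38 / 10.
Proof.
move=> [/andP[q1 q2] /andP[t1 t2]] /andP[x1 x2] /andP[y1 y2]; rewrite /slope.
have : 0 <= (t - 5) * (y - x - 15 / 64) by apply: mulr_ge0; lra.
have : 0 <= (51 / 10 - t) * (y - x) by apply: mulr_ge0; lra.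
lra.
Qed.

Lemma phi_window (q t x y : R) : admissible q t -> left_window x -> right_window y ->
  0 < phi q t x y < 1.
Proof.
move=> [/andP[q1 q2] /andP[t1 t2]] /andP[x1 x2] /andP[y1 y2]; rewrite /phi.
have h1 : 15 / 64 <= y - x by lra.
have h2 : y - x <= 17 / 64 by lra.
move: (y - x) h1 h2 => h h1 h2.
have : 0 <= (1 - q) * h by apply: mulr_ge0; lra.
have : 0 <= (1 + q) * h by apply: mulr_ge0; lra.
have : 0 <= (t - 5) * h ^+ 2 by apply: mulr_ge0; [lra | exact: sqr_ge0].
have : 0 <= (51 / 10 - t) * h ^+ 2 by apply: mulr_ge0; [lra | exact: sqr_ge0].
nra.
Qed.

Lemma phi_shift (q t x y a b : R) :
  phi q t (x + a) (y + b) - phi q t x y =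
  (1 - slope q t x y) * a + slope q t x y * b + t * (b - a) ^+ 2.
Proof. by rewrite /phi /slope; ring. Qed.

(** Here [(X, Y)] is the corner of a box, [(x, y)] a point of the box, [(a, b)] the ideal
    displacement and [(ra, rb)] its rounding error. The three terms come from the rounding, from
    freezing the slope at the corner, and from the second-order term; [phi] being quadratic, there
    is no other. *)
Lemma phi_shift_error (q t x y X Y a b ra rb rho nu A : R) :
  admissible q t -> left_window X -> right_window Y ->
  `|x - X| <= rho -> `|y - Y| <= rho -> `|ra| <= nu -> `|rb| <= nu ->
  `|a + ra| <= A -> `|b + rb| <= A ->
  `|phi q t (x + (a + ra)) (y + (b + rb)) - phi q t x y -
    ((1 - slope q t X Y) * a + slope q t X Y * b)| <= 7 * nu + 41 * rho * A + 21 * A ^+ 2.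
Proof.
move=> adm wX wY hx hy hra hrb ha hb.
have /andP[u1 u2] := slope_bounds adm wX wY.
case: adm => _ /andP[t1 t2].
rewrite phi_shift; set u0 := slope q t X Y in u1 u2 *.
have -> : slope q t x y = u0 + 2 * t * ((y - Y) - (x - X)) by rewrite /u0 /slope; ring.
set a' := a + ra in ha *; set b' := b + rb in hb *.
have -> : (1 - (u0 + 2 * t * (y - Y - (x - X)))) * a' +
  (u0 + 2 * t * (y - Y - (x - X))) * b' + t * (b' - a') ^+ 2 - ((1 - u0) * a + u0 * b) =
  ((1 - u0) * ra + u0 * rb) + (2 * t * ((y - Y) - (x - X))) * (b' - a') + t * (b' - a') ^+ 2.
  by rewrite /a' /b'; ring.
have ba : `|b' - a'| <= 2 * A by apply: (le_trans (ler_normB _ _)); lra.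
have A0 : 0 <= A by apply: le_trans ha.
have r0 : 0 <= rho by apply: le_trans hx.
have n0 : 0 <= nu by apply: le_trans hra.
have e1 : `|(1 - u0) * ra + u0 * rb| <= 7 * nu.
  apply: (le_trans (ler_normD _ _)); rewrite !normrM.
  rewrite (@ler0_norm _ (1 - u0)) ?(@ger0_norm _ u0); [|lra|lra].
  have : 0 <= u0 * (nu - `|rb|) by apply: mulr_ge0; lra.
  have : 0 <= (u0 - 1) * (nu - `|ra|) by apply: mulr_ge0; lra.
  have : 0 <= (38 / 10 - u0) * nu by apply: mulr_ge0; lra.
  lra.
have e2 : `|(2 * t * ((y - Y) - (x - X))) * (b' - a')| <= 41 * rho * A.
  rewrite normrM normrM (@ger0_norm _ (2 * t)); last lra.
  have h : `|y - Y - (x - X)| <= 2 * rho by apply: (le_trans (ler_normB _ _)); lra.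
  have h' : 2 * t * `|y - Y - (x - X)| <= (102 / 10) * (2 * rho).
    by apply: ler_pM => //; lra.
  apply: (@le_trans _ _ ((102 / 10 * (2 * rho)) * (2 * A))).
    by apply: ler_pM => //; apply: mulr_ge0 => //; lra.
  have : 0 <= rho * A by exact: mulr_ge0.
  lra.
have e3 : `|t * (b' - a') ^+ 2| <= 21 * A ^+ 2.
  rewrite normrM normrX (@ger0_norm _ t); last lra.
  have : `|b' - a'| ^+ 2 <= (2 * A) ^+ 2 by rewrite lerXn2r ?nnegrE //; lra.
  rewrite exprMn => h.
  have : t * `|b' - a'| ^+ 2 <= 51 / 10 * (2 ^+ 2 * A ^+ 2).
    by apply: ler_pM => //; lra.
  have : 0 <= A ^+ 2 by exact: sqr_ge0.
  lra.
by apply: (le_trans (ler_normD _ _)); apply: lerD => //; apply: (le_trans (ler_normD _ _));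
    apply: lerD.
Qed.

(* The displacement comes from solving the first three equations; the fourth is
   then solvable because, for the slopes [u = slope (x_i, y_j)] of a rectangle,
   [u21 * u12 - u11 * u22 = 4 t^2 (Y2 - Y1) (X1 - X2)]. *)
Lemma displacement (q t X1 X2 Y1 Y2 e : R) :
  admissible q t -> left_window X1 -> left_window X2 -> right_window Y1 -> right_window Y2 ->
  X1 != X2 -> Y1 != Y2 ->
  exists a1 a2 b1 b2, [/\ (1 - slope q t X1 Y1) * a1 + slope q t X1 Y1 * b1 = 0,
    (1 - slope q t X1 Y2) * a1 + slope q t X1 Y2 * b2 = 0,
    (1 - slope q t X2 Y1) * a2 + slope q t X2 Y1 * b1 = 0 &
    (1 - slope q t X2 Y2) * a2 + slope q t X2 Y2 * b2 = e] /\
   let A := `|e| / (`|X1 - X2| * `|Y1 - Y2|) in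
   [/\ `|a1| <= A, `|a2| <= A, `|b1| <= A & `|b2| <= A].
Proof.
move=> adm wX1 wX2 wY1 wY2 nX nY.
have /andP[l1 r1] := slope_bounds adm wX1 wY1.
have /andP[l2 r2] := slope_bounds adm wX1 wY2.
have /andP[l3 r3] := slope_bounds adm wX2 wY1.
have /andP[l4 r4] := slope_bounds adm wX2 wY2.
have bd (u : R) : 13 / 10 <= u -> u <= 38 / 10 ->
  [/\ 0 <= u, u <= 38 / 10, 0 <= u - 1 & u - 1 <= 38 / 10] by move=> *; split; lra.
have nX' : X1 - X2 != 0 by rewrite subr_eq0.
have nY' : Y1 - Y2 != 0 by rewrite subr_eq0.
have [_ /andP[t1 t2]] := adm.
have E4 : slope q t X2 Y2 = slope q t X1 Y2 + slope q t X2 Y1 - slope q t X1 Y1.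
  by rewrite /slope; ring.
have EP : (slope q t X1 Y2 - slope q t X1 Y1) * (slope q t X2 Y1 - slope q t X1 Y1) =
  - (4 * t ^+ 2 * ((X1 - X2) * (Y1 - Y2))) by rewrite /slope; ring.
move: (slope q t X2 Y2) E4 l4 r4 => u4 E4 l4 r4.
move: (slope q t X1 Y2) (slope q t X2 Y1) (slope q t X1 Y1) l1 l2 l3 r1 r2 r3 E4 EP
  => u2 u3 u1 l1 l2 l3 r1 r2 r3 E4 EP.
set P := (X1 - X2) * (Y1 - Y2) in EP.
have nP : P != 0 by rewrite mulf_neq0.
have nmP : `|P| = `|X1 - X2| * `|Y1 - Y2| by rewrite normrM.
clearbody P; rewrite -nmP.
have nt : t != 0 by lra.
have nS : u2 + u3 - 1 != 0 by lra.
(* The first three equations determine the displacement up to a factor; [k] is the factor that gives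
   the fourth one the value [e]. *)
pose k := - (e / ((u2 + u3 - 1) * (4 * t ^+ 2 * P))).
exists (u1 * u2 * (u3 - 1) * k), (u2 * u3 * (u1 - 1) * k),
  ((u1 - 1) * u2 * (u3 - 1) * k), (u1 * (u2 - 1) * (u3 - 1) * k).
split.
  split; first by ring.
  - by ring.
  - by ring.
  have -> : (1 - u4) * (u2 * u3 * (u1 - 1) * k) + u4 * (u1 * (u2 - 1) * (u3 - 1) * k) =
    k * (u2 + u3 - 1) * ((u2 - u1) * (u3 - u1)) by rewrite E4; ring.
  rewrite EP /k; field.
  by rewrite nP nt nS.
(* 160 bounds [(u2 + u3 - 1) * (4 * t ^+ 2)] from below, by 16/10 and 100. It exceeds the cube of
   38/10, which bounds the products of three factors in the witnesses. *)
have hk : `|k| <= `|e| / `|P| / 160.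
  pose Q := (u2 + u3 - 1) * (4 * t ^+ 2).
  have Q160 : 160 <= Q.
    have : 25 <= t ^+ 2 by nra.
    rewrite /Q; nra.
  have -> : k = - (e / P / Q).
    by rewrite /k /Q; field; rewrite nP nt nS.
  rewrite normrN normf_div normf_div (@ger0_norm _ Q); last lra.
  apply: ler_wpM2l; first by rewrite divr_ge0.
  by rewrite lef_pV2 ?posrE //; lra.
have kP : forall a, 0 <= a -> a <= 160 -> `|a * k| <= `|e| / `|P|.
  move=> a a0 a1; rewrite normrM (ger0_norm a0).
  apply: (@le_trans _ _ (160 * (`|e| / `|P| / 160))).
    by apply: ler_pM.
  by rewrite mulrC divfK ?pnatr_eq0.
have pr (a b c : R) : 0 <= a -> a <= 38 / 10 -> 0 <= b -> b <= 38 / 10 -> 0 <= c -> c <= 38 / 10 ->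
   `|a * b * c * k| <= `|e| / `|P|.
  move=> a0 a1 b0 b1 c0 c1; apply: kP; first by rewrite !mulr_ge0.
  have ab : a * b <= 38 / 10 * (38 / 10) by apply: ler_pM.
  have : a * b * c <= (38 / 10 * (38 / 10)) * (38 / 10) by apply: ler_pM => //; apply: mulr_ge0.
  lra.
have [? ? ? ?] := bd _ l1 r1; have [? ? ? ?] := bd _ l2 r2; have [? ? ? ?] := bd _ l3 r3.
by split; apply: pr.
Qed.

Lemma norm_sum_const (n : nat) (F : 'I_n -> R) (c : R) :
  (forall i, `|F i| <= c) -> `|\sum_i F i| <= n%:R * c.
Proof.
move=> Fc; apply: (le_trans (ler_norm_sum _ _ _)).
apply: (@le_trans _ _ (\sum_(i < n) c)); first by apply: ler_sum.
by rewrite sumr_const card_ord mulr_natl.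
Qed.

(** The four coordinates are shifted one at a time; each shift costs [2 * v * B] on each of J^3
    lines, by [sum_shift]. *)
Lemma box_shift (H : int -> int -> int -> int -> R) (B : R) (J : nat) (v1 v2 v3 v4 : int) (v : R) :
  (forall i j k l, `|H i j k l| <= B) ->
  `|v1|%:~R <= v -> `|v2|%:~R <= v -> `|v3|%:~R <= v -> `|v4|%:~R <= v ->
  `|\sum_(i < J) \sum_(j < J) \sum_(k < J) \sum_(l < J)
     (H (i%:Z + v1) (j%:Z + v2) (k%:Z + v3) (l%:Z + v4) - H i%:Z j%:Z k%:Z l%:Z)| <=
   8 * J%:R ^+ 3 * v * B.
Proof.
move=> HB h1 h2 h3 h4.
have B0 : 0 <= B by exact: le_trans (normr_ge0 _) (HB 0 0 0 0).
pose S1 i := \sum_(j < J) \sum_(k < J) \sum_(l < J) H i (j%:Z + v2) (k%:Z + v3) (l%:Z + v4).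
pose S2 (i : 'I_J) j := \sum_(k < J) \sum_(l < J) H i%:Z j (k%:Z + v3) (l%:Z + v4).
pose S3 (i j : 'I_J) k := \sum_(l < J) H i%:Z j%:Z k (l%:Z + v4).
pose S4 (i j k : 'I_J) l := H i%:Z j%:Z k%:Z l.
have -> : \sum_(i < J) \sum_(j < J) \sum_(k < J) \sum_(l < J)
     (H (i%:Z + v1) (j%:Z + v2) (k%:Z + v3) (l%:Z + v4) - H i%:Z j%:Z k%:Z l%:Z) =
   \sum_(i < J) (S1 (i%:Z + v1) - S1 i%:Z) +
   \sum_(i < J) (\sum_(j < J) (S2 i (j%:Z + v2) - S2 i j%:Z)) +
   \sum_(i < J) (\sum_(j < J) (\sum_(k < J) (S3 i j (k%:Z + v3) - S3 i j k%:Z))) +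
   \sum_(i < J) (\sum_(j < J) (\sum_(k < J) (\sum_(l < J) (S4 i j k (l%:Z + v4) - S4 i j k l%:Z)))).
  rewrite -!big_split; apply: eq_bigr => i _ /=.
  rewrite [S1 _ - _ + _](_ : _ = S1 (i%:Z + v1) - \sum_(j < J) S2 i j%:Z); last first.
    by rewrite sumrB /S1 /S2; ring.
  rewrite [X in _ = X + _](_ : _ = S1 (i%:Z + v1) - \sum_(j < J) \sum_(k < J) S3 i j k%:Z);
      last first.
    rewrite [X in _ - _ + X](_ : _ = \sum_(j < J) S2 i j%:Z - \sum_(j < J) \sum_(k < J) S3 i j
        k%:Z); first by ring.
    by rewrite -sumrB; apply: eq_bigr => j _; rewrite sumrB.
  rewrite [X in _ = _ + X](_ : _ = \sum_(j < J) \sum_(k < J) S3 i j k%:Z -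
     \sum_(j < J) \sum_(k < J) \sum_(l < J) S4 i j k l%:Z); last first.
    rewrite -sumrB; apply: eq_bigr => j _; rewrite -sumrB; apply: eq_bigr => k _.
    by rewrite sumrB.
  rewrite addrA addrNK /S1 -sumrB; apply: eq_bigr => j _.
  rewrite -sumrB; apply: eq_bigr => k _; rewrite -sumrB; apply: eq_bigr => l _.
  by [].
have ns (n : nat) (w : int) (b : R) (h : int -> R) : 0 <= b -> `|w|%:~R <=
    v -> (forall i, `|h i| <= b) ->
   `|\sum_(i < n) (h (i%:Z + w) - h i%:Z)| <= 2 * v * b.
  move=> b0 wv hb; apply: (le_trans (sum_shift n w hb)).
  by apply: ler_wpM2r => //; apply: ler_wpM2l.
have J0 : 0 <= J%:R :> R by [].
have n1 : `|\sum_(i < J) (S1 (i%:Z + v1) - S1 i%:Z)| <= 2 * v * (J%:R * (J%:R * (J%:R * B))).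
  apply: ns => //; first by rewrite !mulr_ge0.
  by move=> i; do 3! apply: norm_sum_const => ?.
have n2 : `|\sum_(i < J) (\sum_(j < J) (S2 i (j%:Z + v2) - S2 i j%:Z))| <=
    J%:R * (2 * v * (J%:R * (J%:R * B))).
  apply: norm_sum_const => i; apply: ns => //; first by rewrite !mulr_ge0.
  by move=> j; do 2! apply: norm_sum_const => ?.
have n3 : `|\sum_(i < J) (\sum_(j < J) (\sum_(k < J) (S3 i j (k%:Z + v3) - S3 i j k%:Z)))| <=
    J%:R * (J%:R * (2 * v * (J%:R * B))).
  do 2! apply: norm_sum_const => ?; apply: ns => //; first by rewrite !mulr_ge0.
  by move=> j; do 1! apply: norm_sum_const => ?.
have n4 : `|\sum_(i < J) (\sum_(j < J) (\sum_(k < J) (\sum_(l < J) (S4 i j k (l%:Z +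
    v4) - S4 i j k l%:Z))))| <=
    J%:R * (J%:R * (J%:R * (2 * v * B))).
  by do 3! apply: norm_sum_const => ?; apply: ns => // l; exact: HB.
rewrite (_ : 8 * _ * _ * _ = 2 * v * (J%:R * (J%:R * (J%:R * B))) +
    J%:R * (2 * v * (J%:R * (J%:R * B)))
  + J%:R * (J%:R * (2 * v * (J%:R * B))) + J%:R * (J%:R * (J%:R * (2 * v * B)))); last by ring.
by do 3! (apply: (le_trans (ler_normD _ _)); apply: lerD => //).
Qed.

(** Meant for three factors [G (z + e) - G z] and one factor [G z]: the former have twice the size
    and twice the variation. The factors are exchanged one by one, at cost 8 M^3 e each. *)
Lemma prod4_diff (a b c d a' b' c' d' M e : R) :
  `|a| <= 2 * M -> `|b| <= 2 * M -> `|c| <= 2 * M -> `|d| <= M ->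
  `|a'| <= 2 * M -> `|b'| <= 2 * M -> `|c'| <= 2 * M -> `|d'| <= M ->
  `|a - a'| <= 2 * e -> `|b - b'| <= 2 * e -> `|c - c'| <= 2 * e -> `|d - d'| <= e ->
  `|a * b * c * d - a' * b' * c' * d'| <= 32 * M ^+ 3 * e.
Proof.
move=> ha hb hc hd ha' hb' hc' hd' ea eb ec ed.
have -> : a * b * c * d - a' * b' * c' * d' =
  (a - a') * b * c * d + a' * (b - b') * c * d + a' * b' * (c - c') * d +
      a' * b' * c' * (d - d') by ring.
have pm (w x y z W X Y Z : R) : `|w| <= W -> `|x| <= X -> `|y| <= Y -> `|z| <= Z ->
   `|w * x * y * z| <= W * X * Y * Z.
  by move=> *; rewrite !normrM; do 3! (apply: ler_pM => //; rewrite ?(mulr_ge0, normr_ge0) //).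
rewrite (_ : 32 * _ * _ = 2 * e * (2 * M) * (2 * M) * M + 2 * M * (2 * e) * (2 * M) * M +
   2 * M * (2 * M) * (2 * e) * M + 2 * M * (2 * M) * (2 * M) * e); last by ring.
by do 3! (apply: (le_trans (ler_normD _ _)); apply: lerD; last exact: pm); exact: pm.
Qed.

End Geometry.

(** * Cancellation on a single box *)

Section Box.
Context {R : realType}.

Lemma round_to_grid (a s : R) : 0 < s -> exists v : int, `|v%:~R * s - a| <= s.
Proof.
move=> s0; exists (Num.floor (a / s)).
have /andP[h1 h2] := floor_itv (a / s).
have -> : (Num.floor (a / s))%:~R * s - a = - ((a / s - (Num.floor (a / s))%:~R) * s).
  by rewrite mulrBl divfK ?gt_eqF //; ring.
rewrite normrN normrM (gtr0_norm s0) ger0_norm ?subr_ge0 //.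
rewrite -[leRHS]mul1r; apply: ler_wpM2r; first exact: ltW.
by rewrite lerBlDl ltW // -intrD1.
Qed.

(* Translating the box by the displacement, rounded to the grid, moves the
   argument of the last factor by [e] and the others hardly at all, so the two
   halves of [D] cancel up to the boundary of the box. *)
Lemma box_bound (q t M L e eta s : R) (G : R -> R) (J : nat) (X1 X2 Y1 Y2 : R)
    (D := fun z : R => G (z + e) - G z) (A := `|e| / eta ^+ 2 + s) :
  admissible q t -> left_window X1 -> left_window X2 -> right_window Y1 -> right_window Y2 ->
  0 < eta -> eta <= `|X1 - X2| -> eta <= `|Y1 - Y2| -> 0 < s ->
  (forall z, `|G z| <= M) -> (forall z z', `|G z - G z'| <= L * `|z - z'|) ->
  `|\sum_(i < J) \sum_(i' < J) \sum_(j < J) \sum_(j' < J)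
     D (phi q t (X1 + i%:R * s) (Y1 + j%:R * s)) * D (phi q t (X1 + i%:R * s) (Y2 + j'%:R * s)) *
     D (phi q t (X2 + i'%:R * s) (Y1 + j%:R * s)) * D (phi q t (X2 + i'%:R * s) (Y2 +
         j'%:R * s))| <=
  J%:R ^+ 4 * (32 * M ^+ 3 * (L * (7 * s + 41 * (J%:R * s) * A + 21 * A ^+ 2))) +
  8 * J%:R ^+ 3 * (A / s) * (8 * M ^+ 4).
Proof.
move=> adm wX1 wX2 wY1 wY2 eta0 etaX etaY s0 GM GL.
have nX : X1 != X2 by rewrite -subr_eq0 -normr_gt0; exact: lt_le_trans etaX.
have nY : Y1 != Y2 by rewrite -subr_eq0 -normr_gt0; exact: lt_le_trans etaY.
have M0 : 0 <= M by exact: le_trans (normr_ge0 _) (GM 0).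
have L0 : 0 <= L by have := GL 1 0; rewrite subr0 normr1 mulr1; apply: le_trans (normr_ge0 _).
have := displacement e adm wX1 wX2 wY1 wY2 nX nY.
move=> [a1 [a2 [b1 [b2 [[E11 E12 E21 E22] [ha1 ha2 hb1 hb2]]]]]].
have bnd : `|e| / (`|X1 - X2| * `|Y1 - Y2|) <= `|e| / eta ^+ 2.
  apply: ler_wpM2l => //; rewrite lef_pV2 ?posrE ?exprn_gt0 //; last first.
    by rewrite mulr_gt0 // normr_gt0 subr_eq0.
  by rewrite expr2 ler_pM // ltW.
have [v1 hv1] := round_to_grid a1 s0; have [v2 hv2] := round_to_grid a2 s0.
have [w1 hw1] := round_to_grid b1 s0; have [w2 hw2] := round_to_grid b2 s0.
have tot (a : R) (v : int) : `|v%:~R * s - a| <= s ->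
    `|a| <= `|e| / (`|X1 - X2| * `|Y1 - Y2|) -> `|a + (v%:~R * s - a)| <= A.
  move=> h1 h2; apply: (le_trans (ler_normD _ _)); apply: lerD => //.
  exact: le_trans bnd.
have totv (a : R) (v : int) : `|a + (v%:~R * s - a)| <= A -> `|v|%:~R <= A / s.
  rewrite addrC subrK normrM (gtr0_norm s0) => h.
  by rewrite ler_pdivlMr // intr_norm.
have tv1 := tot _ _ hv1 ha1; have tv2 := tot _ _ hv2 ha2.
have tw1 := tot _ _ hw1 hb1; have tw2 := tot _ _ hw2 hb2.
pose x1 (i : int) := X1 + i%:~R * s; pose x2 (i : int) := X2 + i%:~R * s.
pose y1 (i : int) := Y1 + i%:~R * s; pose y2 (i : int) := Y2 + i%:~R * s.
(* The last factor is [G] alone: of the two halves of [D] there, [G (z + e)] is close to [H] at the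
   shifted indices, and [G z] is [H] at the original ones. *)
pose H i i' j j' := D (phi q t (x1 i) (y1 j)) * D (phi q t (x1 i) (y2 j')) *
  D (phi q t (x2 i') (y1 j)) * G (phi q t (x2 i') (y2 j')).
have DM z : `|D z| <= 2 * M.
  by apply: (le_trans (ler_normB _ _)); rewrite mulr2n mulrDl !mul1r lerD.
have DL z z' : `|D z - D z'| <= 2 * (L * `|z - z'|).
  have -> : D z - D z' = (G (z + e) - G (z' + e)) - (G z - G z') by rewrite /D; ring.
  apply: (le_trans (ler_normB _ _)); rewrite mulr2n mulrDl !mul1r lerD //.
  apply: (le_trans (GL _ _)); by rewrite (_ : z + e - (z' + e) = z - z') //; ring.
have HM i i' j j' : `|H i i' j j'| <= 8 * M ^+ 4.
  rewrite /H !normrM (_ : 8 * _ = (2 * M) * (2 * M) * (2 * M) * M); last by ring.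
  by do 3! (apply: ler_pM => //; rewrite ?(mulr_ge0, normr_ge0) //).
pose Err := 7 * s + 41 * (J%:R * s) * A + 21 * A ^+ 2.
have grid (X : R) (i : 'I_J) : `|X + i%:R * s - X| <= J%:R * s.
  have -> : X + i%:R * s - X = i%:R * s by ring.
  by rewrite ger0_norm ?mulr_ge0 ?(ltW s0) // ler_wpM2r ?(ltW s0) // ler_nat ltnW.
have err (X Y : R) (a b lin : R) (v w : int) (i j : 'I_J) :
    left_window X -> right_window Y ->
    (1 - slope q t X Y) * a + slope q t X Y * b = lin ->
    `|v%:~R * s - a| <= s -> `|w%:~R * s - b| <= s ->
    `|a + (v%:~R * s - a)| <= A -> `|b + (w%:~R * s - b)| <= A ->
    `|phi q t (X + (i%:Z + v)%:~R * s) (Y + (j%:Z + w)%:~R * s) -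
      (phi q t (X + i%:R * s) (Y + j%:R * s) + lin)| <= Err.
  move=> wX wY lin0 ra rb ta tb.
  have := phi_shift_error adm wX wY (grid X i) (grid Y j) ra rb ta tb.
  rewrite lin0 -addrA -opprD; congr (`|phi _ _ _ _ - _| <= _).
  - by rewrite intrD; ring.
  - by rewrite intrD; ring.
have pt (i i' j j' : 'I_J) :
  `|D (phi q t (X1 + i%:R * s) (Y1 + j%:R * s)) * D (phi q t (X1 + i%:R * s) (Y2 + j'%:R * s)) *
     D (phi q t (X2 + i'%:R * s) (Y1 + j%:R * s)) * G (phi q t (X2 + i'%:R * s) (Y2 +
         j'%:R * s) + e) -
   H (i%:Z + v1) (i'%:Z + v2) (j%:Z + w1) (j'%:Z + w2)| <= 32 * M ^+ 3 * (L * Err).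
  have dd (z z' : R) : `|z' - (z + 0)| <= Err -> `|D z - D z'| <= 2 * (L * Err).
    rewrite addr0 distrC => h; apply: (le_trans (DL _ _)).
    by apply: ler_wpM2l => //; apply: ler_wpM2l.
  apply: prod4_diff => //.
  - by apply: dd; exact: err wX1 wY1 E11 hv1 hw1 tv1 tw1.
  - by apply: dd; exact: err wX1 wY2 E12 hv1 hw2 tv1 tw2.
  - by apply: dd; exact: err wX2 wY1 E21 hv2 hw1 tv2 tw1.
  - apply: (le_trans (GL _ _)); apply: ler_wpM2l => //; rewrite distrC.
    exact: err wX2 wY2 E22 hv2 hw2 tv2 tw2.
rewrite (eq_bigr (fun i : 'I_J => \sum_(i' < J) \sum_(j < J) \sum_(j' < J)
   (D (phi q t (X1 + i%:R * s) (Y1 + j%:R * s)) * D (phi q t (X1 + i%:R * s) (Y2 + j'%:R * s)) *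
     D (phi q t (X2 + i'%:R * s) (Y1 + j%:R * s)) * G (phi q t (X2 + i'%:R * s) (Y2 +
         j'%:R * s) + e) -
   H (i%:Z + v1) (i'%:Z + v2) (j%:Z + w1) (j'%:Z + w2)) +
   \sum_(i' < J) \sum_(j < J) \sum_(j' < J) (H (i%:Z + v1) (i'%:Z + v2) (j%:Z + w1) (j'%:Z + w2) -
     H i%:Z i'%:Z j%:Z j'%:Z))); last first.
  move=> i _; do 3! (rewrite -big_split; apply: eq_bigr => ? _ /=).
  rewrite [D (phi _ _ (X2 + _) (Y2 + _))]/D /H /x1 /x2 /y1 /y2; ring.
rewrite big_split /=; apply: (le_trans (ler_normD _ _)); apply: lerD.
  rewrite (_ : J%:R ^+ 4 * _ = J%:R * (J%:R * (J%:R * (J%:R * (32 * M ^+ 3 * (L * Err))))));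
      last by rewrite /Err; ring.
  by do 4! apply: norm_sum_const => ?.
by apply: box_shift; [exact: HM | exact: totv tv1 | exact: totv tv2 | exact: totv tw1 | exact:
    totv tw2].
Qed.

End Box.

(** * The smoothing estimate *)

Section Oscillation.
Context {R : realType}.

(* The grid of mesh [s] covers the two windows when [W%:R * s = 1 / 64]. *)
Definition pattern_sum (W : nat) (s q t : R) (f0 f1 f2 : R -> R) : R :=
  \sum_(i < W) \sum_(j < W) f0 (1 / 8 + i%:R * s) * f1 (3 / 8 + j%:R * s) *
    f2 (phi q t (1 / 8 + i%:R * s) (3 / 8 + j%:R * s)).

Lemma left_window_grid (W i : nat) (s : R) : W%:R * s = 1 / 64 -> 0 <= s -> (i <= W)%N ->
  left_window (1 / 8 + i%:R * s).
Proof.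
move=> Ws s0 iW; have : i%:R * s <= W%:R * s by rewrite ler_wpM2r // ler_nat.
have : 0 <= i%:R * s by rewrite mulr_ge0.
by rewrite Ws /left_window; lra.
Qed.

Lemma right_window_grid (W i : nat) (s : R) : W%:R * s = 1 / 64 -> 0 <= s -> (i <= W)%N ->
  right_window (3 / 8 + i%:R * s).
Proof.
move=> Ws s0 iW; have : i%:R * s <= W%:R * s by rewrite ler_wpM2r // ler_nat.
have : 0 <= i%:R * s by rewrite mulr_ge0.
by rewrite Ws /right_window; lra.
Qed.

(* Boxes closer than [Dn] boxes to a diagonal, where the displacement is not
   under control, are few and are estimated trivially. *)
Lemma pattern_sum_oscillation (A J Dn : nat) (q t M L e s : R) (f0 f1 G : R -> R)
    (eta := Dn%:R * (J%:R * s)) (V := `|e| / eta ^+ 2 + s) (W := (A * J)%N) :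
  admissible q t -> (0 < Dn)%N -> (0 < J)%N -> 0 < s -> W%:R * s = 1 / 64 ->
  (forall z, `|f0 z| <= M) -> (forall z, `|f1 z| <= M) -> (forall z, `|G z| <= M) ->
  (forall z z', `|G z - G z'| <= L * `|z - z'|) ->
  pattern_sum W s q t f0 f1 (fun z => G (z + e) - G z) ^+ 4 <=
  W%:R ^+ 4 * M ^+ 8 *
  (A%:R ^+ 4 * (J%:R ^+ 4 * (32 * M ^+ 3 * (L * (7 * s + 41 * (J%:R * s) * V + 21 * V ^+ 2))) +
      8 * J%:R ^+ 3 * (V / s) * (8 * M ^+ 4)) +
   64 * M ^+ 4 * J%:R ^+ 4 * A%:R ^+ 3 * Dn%:R).
Proof.
move=> adm Dn0 J0 s0 Ws f0M f1M GM GL.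
have M0 : 0 <= M by exact: le_trans (normr_ge0 _) (GM 0).
pose D z := G (z + e) - G z.
have DM z : `|D z| <= 2 * M.
  by apply: (le_trans (ler_normB _ _)); rewrite mulr2n mulrDl !mul1r lerD.
pose F (i j : nat) := D (phi q t (1 / 8 + i%:R * s) (3 / 8 + j%:R * s)).
have := @box_CauchySchwarz R 'I_W 'I_W (fun i => f0 (1 / 8 + i%:R * s))
  (fun j => f1 (3 / 8 + j%:R * s)) (fun i j => F i j) M (fun i => f0M _) (fun j => f1M _).
rewrite !card_ord -expr2 -exprM => CS; apply: (le_trans CS).
apply: ler_wpM2l; first by rewrite mulr_ge0 ?exprn_ge0.
(* In each variable the [A * J] grid points form [A] blocks of length [J]. *)
pose Box (a a' c c' : nat) := \sum_(b < J) \sum_(b' < J) \sum_(d < J) \sum_(d' < J)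
  F (a * J + b)%N (c * J + d)%N * F (a * J + b)%N (c' * J + d')%N *
  F (a' * J + b')%N (c * J + d)%N * F (a' * J + b')%N (c' * J + d')%N.
have -> : \sum_(i < W) \sum_(i' < W) \sum_(j < W) \sum_(j' < W) F i j * F i j' * F i' j * F i' j' =
   \sum_(a < A) \sum_(a' < A) \sum_(c < A) \sum_(c' < A) Box a a' c c'.
  rewrite (big_ord_mul A J (fun i => \sum_(i' < W) \sum_(j < W) \sum_(j' < W) F i j * F i j' *
      F i' j * F i' j')).
  apply: eq_bigr => a _.
  under eq_bigr => b _.
    rewrite (big_ord_mul A J (fun i' => \sum_(j < W) \sum_(j' < W) F (a * J +
        b)%N j * F (a * J + b)%N j' * F i' j * F i' j')).
    over.
  rewrite exchange_big; apply: eq_bigr => a' _.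
  under eq_bigr => b _.
    under eq_bigr => b' _.
      rewrite (big_ord_mul A J (fun j => \sum_(j' < W) F (a * J + b)%N j * F (a * J +
          b)%N j' * F (a' * J + b')%N j * F (a' * J + b')%N j')).
      over.
    rewrite exchange_big /=; over.
  rewrite exchange_big; apply: eq_bigr => c _.
  under eq_bigr => b _.
    under eq_bigr => b' _.
      under eq_bigr => d _.
        rewrite (big_ord_mul A J (fun j' => F (a * J + b)%N (c * J + d)%N * F (a * J +
            b)%N j' * F (a' * J + b')%N (c * J + d)%N * F (a' * J + b')%N j')).
        over.
      rewrite exchange_big /=; over.
    rewrite exchange_big /=; over.
  by rewrite exchange_big.
set g := J%:R ^+ 4 * _ + 8 * _ * _ * _.
have g0 : 0 <= g.
  have L0 : 0 <= L by have := GL 1 0; rewrite subr0 normr1 mulr1; apply: le_trans (normr_ge0 _).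
  have V0 : 0 <= V by rewrite addr_ge0 ?(ltW s0) // divr_ge0 // exprn_ge0 // !mulr_ge0 // ltW.
  have s' := ltW s0.
  have E0 : 0 <= 7 * s + 41 * (J%:R * s) * V + 21 * V ^+ 2.
    by rewrite !addr_ge0 // ?mulr_ge0 // ?exprn_ge0 // ?mulr_ge0 // ?mulr_ge0.
  have p3 : 0 <= M ^+ 3 by rewrite exprn_ge0.
  have p4 : 0 <= M ^+ 4 by rewrite exprn_ge0.
  have j3 : 0 <= J%:R ^+ 3 :> R by rewrite exprn_ge0.
  have j4 : 0 <= J%:R ^+ 4 :> R by rewrite exprn_ge0.
  have vs : 0 <= V / s by rewrite divr_ge0.
  apply: addr_ge0; first by do ! apply: mulr_ge0.
  by rewrite mulr_ge0 // mulr_ge0 // mulr_ge0.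
(* The second term serves the blocks that are close in one of the variables; they are estimated by
   [2 * M] for each factor [D]. *)
have bound (a a' c c' : 'I_A) : Box a a' c c' <= g + J%:R ^+ 4 * (16 * M ^+ 4) *
   ((`|a%:Z - a'%:Z|%N < Dn)%N%:R + (`|c%:Z - c'%:Z|%N < Dn)%N%:R).
  have triv : Box a a' c c' <= J%:R ^+ 4 * (16 * M ^+ 4).
    apply: (le_trans (ler_norm _)).
    rewrite (_ : J%:R ^+ 4 * _ = J%:R * (J%:R * (J%:R * (J%:R * (2 * M * (2 * M) * (2 * M) *
        (2 * M)))))); last by ring.
    do 4! apply: norm_sum_const => ?.
    by rewrite !normrM; do 3! (apply: ler_pM => //; rewrite ?(mulr_ge0, normr_ge0) //;
        try exact: DM).
  have c0 : 0 <= J%:R ^+ 4 * (16 * M ^+ 4) :> R by rewrite !mulr_ge0 ?exprn_ge0.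
  have [na|fa] := ltnP `|a%:Z - a'%:Z| Dn.
    apply: (le_trans triv); rewrite -[leLHS]add0r lerD // -[leLHS]mulr1 ler_wpM2l //.
    by rewrite lerDl.
  have [nc|fc] := ltnP `|c%:Z - c'%:Z| Dn.
    by apply: (le_trans triv); rewrite -[leLHS]add0r lerD // -[leLHS]mulr1 ler_wpM2l // add0r.
  rewrite addr0 mulr0 addr0.
  have sh (z x y : R) : z + x - (z + y) = x - y by ring.
  have XE (z : R) (m b : nat) : z + (m * J + b)%:R * s = z + m%:R * J%:R * s + b%:R * s.
    by rewrite natrD natrM; ring.
  have aux (m n : 'I_A) : (Dn <= `|m%:Z - n%:Z|)%N ->
     eta <= `|m%:R * J%:R * s - n%:R * J%:R * s|.
    move=> h; rewrite -!mulrA -mulrBl normrM (@ger0_norm _ (J%:R * s)) ?mulr_ge0 ?(ltW s0) //.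
    apply: ler_wpM2r; first by rewrite mulr_ge0 ?(ltW s0).
    apply: (@le_trans _ _ (`|m%:Z - n%:Z|%N%:R)); first by rewrite ler_nat.
    by rewrite natr_absz intr_norm intrB.
  have sJ (m : 'I_A) : (m * J <= W)%N by rewrite leq_mul2r ltnW ?orbT.
  have wl (m : 'I_A) := left_window_grid Ws (ltW s0) (sJ m).
  have wr (m : 'I_A) := right_window_grid Ws (ltW s0) (sJ m).
  rewrite /Box /F; apply: (le_trans (ler_norm _)).
  have := @box_bound R q t M L e eta s G J (1 / 8 + a%:R * J%:R * s) (1 / 8 + a'%:R * J%:R * s)
    (3 / 8 + c%:R * J%:R * s) (3 / 8 + c'%:R * J%:R * s) adm.
  have := wl a; have := wl a'; have := wr c; have := wr c'; rewrite !natrM => h1 h2 h3 h4 h.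
  have {h} := h h4 h3 h2 h1 _ _ _ s0 GM GL.
  rewrite -/V -/g => h; under eq_bigr do under eq_bigr do under eq_bigr do under eq_bigr do
      rewrite !XE.
  apply: h.
  - by rewrite !mulr_gt0 // ltr0n.
  - by rewrite sh; exact: aux.
  - by rewrite sh; exact: aux.
apply: (@le_trans _ _ (\sum_(a < A) \sum_(a' < A) \sum_(c < A) \sum_(c' < A)
  (g + J%:R ^+ 4 * (16 * M ^+ 4) *
   ((`|a%:Z - a'%:Z|%N < Dn)%N%:R + (`|c%:Z - c'%:Z|%N < Dn)%N%:R)))).
  by do 4! (apply: ler_sum => ? _).
set P := \sum_(b < A) \sum_(b' < A) (`|b%:Z - b'%:Z|%N < Dn)%N%:R : R.
have HP : P <= A%:R * (2 * Dn%:R) by exact: sum_near_diagonal.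
have -> : \sum_(a < A) \sum_(a' < A) \sum_(c < A) \sum_(c' < A)
  (g + J%:R ^+ 4 * (16 * M ^+ 4) *
   ((`|a%:Z - a'%:Z|%N < Dn)%N%:R + (`|c%:Z - c'%:Z|%N < Dn)%N%:R)) =
  A%:R ^+ 4 * g + J%:R ^+ 4 * (16 * M ^+ 4) * (A%:R ^+ 2 * P + A%:R ^+ 2 * P).
  have sc (x : R) : \sum_(i < A) x = A%:R * x by rewrite sumr_const card_ord mulr_natl.
  move: (J%:R ^+ 4 * _) => K; clearbody g; pose y (b b' : 'I_A) : R :=
      (`|b%:Z - b'%:Z|%N < Dn)%N%:R.
  transitivity (\sum_(a < A) \sum_(a' < A) (A%:R ^+ 2 * g + K * (A%:R ^+ 2 * y a a' + P))).
    apply: eq_bigr => a _; apply: eq_bigr => a' _.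
    transitivity (\sum_(c < A) (A%:R * g + K * (A%:R * y a a' + \sum_(c' < A) y c c'))).
      by apply: eq_bigr => c _; rewrite big_split /= sc -mulr_sumr big_split /= sc.
    by rewrite big_split /= sc -mulr_sumr big_split /= sc -/P mulrA -expr2 mulrA -expr2.
  transitivity (\sum_(a < A) (A%:R * (A%:R ^+ 2 * g) + K * (A%:R ^+ 2 * (\sum_(a' < A) y a a') +
      A%:R * P))).
    by apply: eq_bigr => a _; rewrite big_split /= sc -mulr_sumr big_split /= sc -mulr_sumr.
  rewrite big_split /= sc -mulr_sumr big_split /= sc -mulr_sumr -/P; ring.
rewrite lerD2l.
apply: (@le_trans _ _ (J%:R ^+ 4 * (16 * M ^+ 4) * (A%:R ^+ 2 * (A%:R * (2 * Dn%:R)) +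
    A%:R ^+ 2 * (A%:R * (2 * Dn%:R))))).
  apply: ler_wpM2l; first by rewrite !mulr_ge0 ?exprn_ge0.
  by rewrite lerD // ler_wpM2l ?exprn_ge0.
by rewrite le_eqVlt; apply/orP; left; apply/eqP; ring.
Qed.

End Oscillation.

(** * Choice of the box parameters *)

Section Dyadic.
Context {R : realType}.

Lemma grid_size (n : nat) : (6 <= n)%N -> (2 ^ (n - 6))%N%:R * (1 / 2) ^+ n = 1 / 64 :> R.
Proof.
move=> n6; rewrite -{2}(subnK n6) exprD natrX mulrA -exprMn.
rewrite (_ : 2%:R * (1 / 2) = 1 :> R); last by field.
by rewrite expr1n !mul1r exprVn -natrX.
Qed.

(** With th = 2^(-k), boxes have side th^12 and their distance from the diagonals is at least th^4,
    so displacements are at most 2 th^16. Three losses result: the boundary of a box, th^16 / th^12;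
    the freezing error th^12 th^16 times a Lipschitz constant of order th^(-24); and the proportion
    of blocks near a diagonal. All are of order th^4, and the fourth root gives th. *)
Lemma pattern_sum_dyadic_oscillation (n k : nat) (q t M L e : R) (f0 f1 G : R -> R) :
  admissible q t -> (0 < k)%N -> (28 * k <= n)%N ->
  `|e| <= (1 / 2) ^+ (24 * k) -> L <= M * 2 ^+ (24 * k + 24) ->
  (forall z, `|f0 z| <= M) -> (forall z, `|f1 z| <= M) -> (forall z, `|G z| <= M) ->
  (forall z z', `|G z - G z'| <= L * `|z - z'|) ->
  `|pattern_sum (2 ^ (n - 6)) ((1 / 2) ^+ n) q t f0 f1 (fun z => G (z + e) - G z)| <=
  ((2 ^ (n - 6))%N%:R) ^+ 2 * (2 ^+ 10 * M ^+ 3 * (1 / 2) ^+ k).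
Proof.
move=> adm k0 kn he hL f0M f1M GM GL.
have M0 : 0 <= M by exact: le_trans (normr_ge0 _) (GM 0).
pose A := (2 ^ (12 * k - 6))%N; pose J := (2 ^ (n - 12 * k))%N; pose Dn := (2 ^ (8 * k))%N.
have EW : (2 ^ (n - 6) = A * J)%N by rewrite -expnD; congr (2 ^ _)%N; lia.
pose s : R := (1 / 2) ^+ n.
have s0 : 0 < s by rewrite exprn_gt0.
have Ws : (A * J)%N%:R * s = 1 / 64 by rewrite -EW grid_size //; lia.
have A0 : 0 < A%:R :> R by rewrite ltr0n expn_gt0.
have J0 : 0 < J%:R :> R by rewrite ltr0n expn_gt0.
have := @pattern_sum_oscillation R A J Dn q t M L e s f0 f1 G adm _ _ s0 Ws f0M f1M GM GL.
rewrite !expn_gt0 /= => /(_ isT isT).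
pose th : R := (1 / 2) ^+ k.
have th0 : 0 < th by rewrite exprn_gt0.
have th1 : th <= 1 by rewrite exprn_ile1 //; lra.
have half2 (m : nat) : 2 ^+ m * (1 / 2) ^+ m = 1 :> R.
  by rewrite -exprMn (_ : 2 * (1 / 2) = 1 :> R) ?expr1n //; field.
have hth (m : nat) : (1 / 2) ^+ (m * k) = th ^+ m :> R by rewrite /th -exprM mulnC.
have EJ : J%:R * s = th ^+ 12.
  rewrite -hth /s -[in (1/2) ^+ n](subnK (_ : 12 * k <= n)%N); last by lia.
  by rewrite exprD natrX mulrA half2 mul1r.
have ED : Dn%:R * th ^+ 12 = th ^+ 4.
  by rewrite (exprD _ 8 4) mulrA -(hth 8) natrX half2 mul1r.
have EA : A%:R * th ^+ 12 = 1 / 64 by rewrite -EJ mulrA -natrM.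
have hs : s <= th ^+ 28.
  rewrite -hth /s; apply: ler_wiXn2l => //; lra.
rewrite EJ ED -EW; set V := _ / _ + s.
have hV : V <= 2 * th ^+ 16.
  rewrite mulr2n mulrDl mul1r; apply: lerD; last first.
    by apply: (le_trans hs); apply: ler_wiXn2l => //; exact: ltW.
  rewrite ler_pdivrMr ?exprn_gt0 // -exprM -exprD.
  by move: he; rewrite hth.
have V0 : 0 <= V by rewrite addr_ge0 ?(ltW s0) // divr_ge0 // exprn_ge0 // exprn_ge0 // ltW.
have L0 : 0 <= L by have := GL 1 0; rewrite subr0 normr1 mulr1; apply: le_trans (normr_ge0 _).
set W := (2 ^ (n - 6))%N; have EWr : W%:R = A%:R * J%:R :> R by rewrite -natrM -EW.
set E := 7 * s + 41 * th ^+ 12 * V + 21 * V ^+ 2.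
have t4 : 0 <= th ^+ 4 by rewrite exprn_ge0 ?ltW.
have hE : E <= 173 * th ^+ 28.
  have h1 : th ^+ 12 * V <= th ^+ 12 * (2 * th ^+ 16) by rewrite ler_wpM2l // exprn_ge0 ?ltW.
  have h2 : V ^+ 2 <= (2 * th ^+ 16) ^+ 2.
    by rewrite lerXn2r ?nnegrE // mulr_ge0 // exprn_ge0 ?ltW.
  have e2 : th ^+ 12 * (2 * th ^+ 16) = 2 * th ^+ 28 by ring.
  have e3 : (2 * th ^+ 16) ^+ 2 = 4 * (th ^+ 28 * th ^+ 4) by ring.
  have h3 : th ^+ 28 * th ^+ 4 <= th ^+ 28 * 1.
    by apply: ler_wpM2l; [rewrite exprn_ge0 ?ltW | rewrite exprn_ile1 // ltW].
  rewrite /E; lra.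
have E0 : 0 <= E by rewrite !addr_ge0 // ?mulr_ge0 // ?exprn_ge0 ?mulr_ge0 // ltW.
have hLE : L * E <= M * 2 ^+ 24 * (173 * th ^+ 4).
  have -> : M * 2 ^+ 24 * (173 * th ^+ 4) = (M * 2 ^+ (24 * k + 24)) * (173 * th ^+ 28).
    rewrite (exprD _ (24 * k)) (_ : th ^+ 28 = th ^+ 24 * th ^+ 4); last by rewrite -exprD.
    have := half2 (24 * k)%N; rewrite hth => h.
    transitivity (M * 2 ^+ 24 * (173 * th ^+ 4) * (2 ^+ (24 * k) * th ^+ 24)); last by ring.
    by rewrite h mulr1.
  by apply: ler_pM.
have hVJ : J%:R ^+ 3 * (V / s) <= J%:R ^+ 4 * (2 * th ^+ 4).
  have -> : J%:R ^+ 3 * (V / s) = J%:R ^+ 4 * (V / th ^+ 12).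
    by rewrite -EJ; field; rewrite !gt_eqF.
  apply: ler_wpM2l; first by rewrite exprn_ge0.
  rewrite ler_pdivrMr ?exprn_gt0 //.
  by apply: (le_trans hV); rewrite -mulrA -exprD.
have hD : A%:R ^+ 3 * Dn%:R = A%:R ^+ 4 * (64 * th ^+ 4).
  rewrite -ED (_ : A%:R ^+ 4 * _ = A%:R ^+ 3 * Dn%:R * (64 * (A%:R * th ^+ 12))); last by ring.
  by rewrite EA (_ : 64 * (1 / 64) = 1 :> R) ?mulr1 //; field.
move=> main.
have {main} : pattern_sum W s q t f0 f1 (fun z => G (z + e) - G z) ^+ 4 <=
   (W%:R ^+ 2 * (2 ^+ 10 * M ^+ 3 * th)) ^+ 4.
  apply: (le_trans main).
  have -> : (W%:R ^+ 2 * (2 ^+ 10 * M ^+ 3 * th)) ^+ 4 =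
     W%:R ^+ 4 * M ^+ 8 * (W%:R ^+ 4 * (2 ^+ 10 ^+ 4 * M ^+ 4 * th ^+ 4)) by ring.
  apply: ler_wpM2l; first by rewrite mulr_ge0 ?exprn_ge0.
  have -> : 64 * M ^+ 4 * J%:R ^+ 4 * A%:R ^+ 3 * Dn%:R =
     64 * M ^+ 4 * J%:R ^+ 4 * (A%:R ^+ 3 * Dn%:R) by ring.
  rewrite hD.
  have p1 : 32 * M ^+ 3 * (L * E) <= 32 * M ^+ 3 * (M * 2 ^+ 24 * (173 * th ^+ 4)).
    by rewrite ler_wpM2l // mulr_ge0 // exprn_ge0.
  have p2 : 8 * J%:R ^+ 3 * (V / s) * (8 * M ^+ 4) <= J%:R ^+ 4 * (2 * th ^+ 4) * (64 * M ^+ 4).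
    rewrite (_ : 8 * _ * _ * _ = J%:R ^+ 3 * (V / s) * (64 * M ^+ 4)); last by ring.
    by rewrite ler_wpM2r // mulr_ge0 // exprn_ge0.
  apply: (@le_trans _ _ (A%:R ^+ 4 * (J%:R ^+ 4 * (32 * M ^+ 3 * (M * 2 ^+ 24 * (173 * th ^+ 4))) +
    J%:R ^+ 4 * (2 * th ^+ 4) * (64 * M ^+ 4)) + 64 * M ^+ 4 * J%:R ^+ 4 * (A%:R ^+ 4 * (64 *
        th ^+ 4)))).
    rewrite lerD2r; apply: ler_wpM2l; first by rewrite exprn_ge0.
    by apply: lerD => //; apply: ler_wpM2l => //; rewrite exprn_ge0.
  rewrite EWr.
  have -> : A%:R ^+ 4 * (J%:R ^+ 4 * (32 * M ^+ 3 * (M * 2 ^+ 24 * (173 * th ^+ 4))) +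
    J%:R ^+ 4 * (2 * th ^+ 4) * (64 * M ^+ 4)) + 64 * M ^+ 4 * J%:R ^+ 4 * (A%:R ^+ 4 * (64 *
        th ^+ 4)) =
    (A%:R * J%:R) ^+ 4 * ((5536 * 2 ^+ 24 + 4224) * (M ^+ 4 * th ^+ 4)) by ring.
  apply: ler_wpM2l; first by rewrite exprn_ge0 // mulr_ge0 ?ltW.
  rewrite -[X in _ <= X]mulrA; apply: ler_wpM2r; first by rewrite mulr_ge0 ?exprn_ge0.
  have h1 : 5536 <= 2 ^+ 13 :> R by rewrite -natrX ler_nat.
  have h2 : 4224 <= 2 ^+ 13 :> R by rewrite -natrX ler_nat.
  have h3 : 1 <= 2 ^+ 24 :> R by rewrite exprn_ege1 // ler1n.
  apply: (@le_trans _ _ (2 ^+ 13 * 2 ^+ 24 + 2 ^+ 13 * 2 ^+ 24)).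
    apply: lerD; first by apply: ler_wpM2r h1; exact: exprn_ge0.
    by apply: (le_trans h2); rewrite ler_peMr // exprn_ge0.
  rewrite -exprM -!exprD (_ : _ + _ = 2 ^+ 38 :> R); last by rewrite [RHS]exprS mulr2n mulrDl
      !mul1r.
  by apply: ler_weXn2l; rewrite // ler1n.
have e4 (x : R) : x ^+ 4 = `|x| ^+ 4 by rewrite -normrX ger0_norm // exprn_even_ge0.
rewrite (e4 (pattern_sum _ _ _ _ _ _ _)) ler_pXn2r // nnegrE //.
by rewrite !mulr_ge0 ?exprn_ge0 // ltW.
Qed.

End Dyadic.

(** * Telescoping over the scales *)

Section Telescoping.
Context {R : realType}.

(** [g] is the growth per scale, and [n] the last scale at which cell masses are controlled. The
    last clause is the two-scale relation of the hat function. The constant 6 is 3 + 3: two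
    intervals of radius 2^(-k) enter the Lipschitz bound, and each meets at most three cells. *)
Definition mollified (n : nat) (g : R) (f : nat -> R -> R) : Prop :=
  [/\ forall k z, 0 <= f k z,
      forall k z, (k <= n)%N -> f k z <= 6 * g ^+ k,
      forall k z z', (k <= n)%N -> `|f k z - f k z'| <= 6 * g ^+ k * 2 ^+ k * `|z - z'| &
      forall k z, f k z = 1 / 4 * f k.+1 (z - (1 / 2) ^+ k.+1) + 1 / 2 * f k.+1 z +
                          1 / 4 * f k.+1 (z + (1 / 2) ^+ k.+1)].

(** This puts the difference of consecutive densities in the form [G (z + e) - G z] of the smoothing
    estimate. *)
Lemma mollified_step n g f k z : mollified n g f ->
  f k z - f k.+1 z = 1 / 4 * (f k.+1 (z + (1 / 2) ^+ k.+1) - f k.+1 z) +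
                     1 / 4 * (f k.+1 (z + - (1 / 2) ^+ k.+1) - f k.+1 z).
Proof. by case=> _ _ _ ->; lra. Qed.

Lemma pattern_sumB3 W s q t f0 f1 (f h : R -> R) :
  pattern_sum W s q t f0 f1 f - pattern_sum W s q t f0 f1 h =
  pattern_sum W s q t f0 f1 (fun z => f z - h z).
Proof.
rewrite /pattern_sum -sumrB; apply: eq_bigr => i _; rewrite -sumrB; apply: eq_bigr => j _; ring.
Qed.

Lemma pattern_sum_step3 W s q t f0 f1 (f h h' : R -> R) (a : R) :
  (forall z, f z = a * h z + a * h' z) ->
  pattern_sum W s q t f0 f1 f =
  a * pattern_sum W s q t f0 f1 h + a * pattern_sum W s q t f0 f1 h'.
Proof.
move=> E; rewrite /pattern_sum !mulr_sumr -big_split; apply: eq_bigr => i _ /=.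
rewrite !mulr_sumr -big_split; apply: eq_bigr => j _ /=; rewrite E; ring.
Qed.

Lemma mollified_bound n g f k K z : mollified n g f -> 1 <= g -> (k <= K)%N -> (K <= n)%N ->
  `|f k z| <= 6 * g ^+ K.
Proof.
case=> f0 fM _ _ g1 kK Kn; rewrite ger0_norm //; apply: (le_trans (fM k z (leq_trans kK Kn))).
by rewrite ler_wpM2l // ler_weXn2l.
Qed.

Lemma mollified_Lipschitz n g f k K z z' : mollified n g f -> 1 <= g -> (k <= K)%N -> (K <= n)%N ->
  `|f k z - f k z'| <= 6 * g ^+ K * 2 ^+ k * `|z - z'|.
Proof.
case=> f0 _ fL _ g1 kK Kn; apply: (le_trans (fL k z z' (leq_trans kK Kn))).
by rewrite ler_wpM2r // ler_wpM2r ?exprn_ge0 // ler_wpM2l // ler_weXn2l.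
Qed.

Lemma half_le (a b : nat) : (a <= b)%N -> (1 / 2) ^+ b <= (1 / 2) ^+ a :> R.
Proof. by move=> ab; apply: ler_wiXn2l => //; lra. Qed.

Lemma quarters (x y B : R) : `|x| <= B -> `|y| <= B -> `|1 / 4 * x + 1 / 4 * y| <= 1 / 2 * B.
Proof.
rewrite !ler_norml => /andP[? ?] /andP[? ?]; apply/andP; split; lra.
Qed.

Section Third.
Variables (n N K : nat) (g q t : R) (f : nat -> R -> R) (f0 f1 : R -> R).
Hypotheses (adm : admissible q t) (fm : mollified n g f) (g1 : 1 <= g) (Kn : (K <= n)%N).
Let M := 6 * g ^+ K.
Let PS := pattern_sum (2 ^ (N - 6)) ((1 / 2) ^+ N) q t f0 f1.
Let W2 : R := (2 ^ (N - 6))%N%:R ^+ 2.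
Hypotheses (f0M : forall z, `|f0 z| <= M) (f1M : forall z, `|f1 z| <= M).

Let M0 : 0 <= M.
Proof. exact: le_trans (normr_ge0 _) (f0M 0). Qed.

(** Scales are grouped in blocks of 24: in block [k] the oscillation has step at most 2^(-24 k), and
    the Lipschitz constant exceeds M 2^(24 k) by at most a factor 2^24. *)
Lemma third_step (k j : nat) : (0 < k)%N -> (28 * k <= N)%N -> (24 * k <= j < 24 * k + 24)%N ->
  (j < K)%N -> `|PS (f j) - PS (f j.+1)| <= W2 * (2 ^+ 9 * M ^+ 3 * (1 / 2) ^+ k).
Proof.
move=> k0 kN /andP[kj jk] jK; rewrite /PS pattern_sumB3.
rewrite (pattern_sum_step3 _ _ _ _ _ _ (fun z => mollified_step j z fm)).
have osc e : `|e| = (1 / 2) ^+ j.+1 ->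
   `|PS (fun z => f j.+1 (z + e) - f j.+1 z)| <= W2 * (2 ^+ 10 * M ^+ 3 * (1 / 2) ^+ k).
  move=> he; apply: (@pattern_sum_dyadic_oscillation _ N k q t M (M * 2 ^+ j.+1)) => //.
  - by rewrite he; apply: half_le; lia.
  - by rewrite ler_wpM2l // ler_weXn2l ?ler1n //; lia.
  - by move=> z; exact: mollified_bound fm g1 jK Kn.
  - by move=> z z'; exact: mollified_Lipschitz fm g1 jK Kn.
have e0 : `|(1 / 2) ^+ j.+1 : R| = (1 / 2) ^+ j.+1 by rewrite ger0_norm // exprn_ge0 //; lra.
have h1 := osc _ e0.
have h2 : `|- (1 / 2) ^+ j.+1 : R| = (1 / 2) ^+ j.+1 by rewrite normrN.
have {}h2 := osc _ h2.
have -> : W2 * (2 ^+ 9 * M ^+ 3 * (1 / 2) ^+ k) = 1 / 2 * (W2 * (2 ^+ 10 * M ^+ 3 * (1 / 2) ^+ k)).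
  by rewrite (exprS 2 9); field.
exact: quarters.
Qed.

Lemma third_block (k i : nat) : (0 < k)%N -> (28 * k <= N)%N -> (i <= 24)%N -> (24 * k + i <=
    K)%N ->
  `|PS (f (24 * k)%N) - PS (f (24 * k + i)%N)| <= i%:R * (W2 * (2 ^+ 9 * M ^+ 3 * (1 / 2) ^+ k)).
Proof.
move=> k0 kN; elim: i => [|i IH] i24 iK; first by rewrite addn0 subrr normr0 mul0r.
rewrite -(subrKA (PS (f (24 * k + i)%N))); apply: (le_trans (ler_normD _ _)).
set Q := W2 * _; rewrite -[i.+1%:R]natr1 mulrDl mul1r; apply: lerD; first by apply: IH; lia.
by rewrite addnS; apply: third_step => //; lia.
Qed.

Lemma third_telescope (a m : nat) : (0 < a)%N -> (28 * (a + m) <= N)%N -> (24 * (a + m) <= K)%N ->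
  `|PS (f (24 * a)%N) - PS (f (24 * (a + m))%N)| <=
  W2 * (2 ^+ 15 * M ^+ 3 * ((1 / 2) ^+ a - (1 / 2) ^+ (a + m))).
Proof.
move=> a0; elim: m => [|m IH] mN mK; first by rewrite addn0 !subrr normr0 !mulr0.
rewrite -(subrKA (PS (f (24 * (a + m))%N))); apply: (le_trans (ler_normD _ _)).
have h1 := IH ltac:(lia) ltac:(lia).
have h2 : `|PS (f (24 * (a + m))%N) - PS (f (24 * (a + m) + 24)%N)| <= _ := third_block (k :=
    a + m) (i := 24) ltac:(lia) ltac:(lia) ltac:(lia) ltac:(lia).
rewrite (_ : (24 * (a + m.+1) = 24 * (a + m) + 24)%N); last lia.
apply: (le_trans (lerD h1 h2)).
rewrite addnS [(1 / 2) ^+ _.+1]exprS; set h := (1 / 2) ^+ (a + m).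
have -> : 2 ^+ 15 = 64 * 2 ^+ 9 :> R by ring.
set B := 2 ^+ 9 : R; set Q := W2 * (B * M ^+ 3 * h).
have Q0 : 0 <= Q.
  have W0 : 0 <= W2 by rewrite /W2 exprn_ge0.
  have h0 : 0 <= h by rewrite /h exprn_ge0 //; lra.
  have B0 : 0 <= B by rewrite /B exprn_ge0.
  by apply: mulr_ge0 => //; apply: mulr_ge0 => //; apply: mulr_ge0 => //; exact: exprn_ge0.
(* The 24 steps of the new block cost at most [24 * Q], while the right-hand side grows by
   [32 * Q]. *)
have -> : W2 * (64 * B * M ^+ 3 * ((1 / 2) ^+ a - 1 / 2 * h)) =
   W2 * (64 * B * M ^+ 3 * ((1 / 2) ^+ a - h)) + 32 * Q by rewrite /Q; field.
rewrite -/Q; lra.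
Qed.

End Third.

(** Summation by parts: the translation passes from the rough factor [F] to the slowly varying [c],
    up to boundary terms. *)
Lemma oscillating_sum (W : nat) (s x0 M C E : R) (v : int) (F c : R -> R) :
  (forall z, `|F z| <= M) -> (forall z, `|c z| <= C) ->
  (forall i : 'I_W, `|c (x0 + i%:R * s + v%:~R * s) - c (x0 + i%:R * s)| <= E) ->
  `|\sum_(i < W) (F (x0 + i%:R * s + v%:~R * s) - F (x0 + i%:R * s)) * c (x0 + i%:R * s)| <=
  2 * `|v|%:~R * (M * C) + W%:R * (M * E).
Proof.
move=> FM cC cE; pose h (i : int) := F (x0 + i%:~R * s) * c (x0 + i%:~R * s).
have -> : \sum_(i < W) (F (x0 + i%:R * s + v%:~R * s) - F (x0 + i%:R * s)) * c (x0 + i%:R * s) =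
  \sum_(i < W) (h (i%:Z + v) - h i%:Z) - \sum_(i < W) F (x0 + i%:R * s + v%:~R * s) *
     (c (x0 + i%:R * s + v%:~R * s) - c (x0 + i%:R * s)).
  rewrite -sumrB; apply: eq_bigr => i _; rewrite /h.
  have -> : x0 + (i%:Z + v)%:~R * s = x0 + i%:R * s + v%:~R * s by rewrite intrD; ring.
  rewrite -pmulrn; ring.
apply: (le_trans (ler_normB _ _)); apply: lerD.
  by apply: sum_shift => i; rewrite normrM ler_pM.
by apply: norm_sum_const => i; rewrite normrM ler_pM.
Qed.

Lemma phi_shift_l (q t x y a : R) : admissible q t -> left_window x -> right_window y -> `|a| <=
    1 ->
  `|phi q t (x + a) y - phi q t x y| <= 9 * `|a|.
Proof.
move=> adm wx wy a1; have := phi_shift q t x y a 0; rewrite addr0 => ->.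
have /andP[u1 u2] := slope_bounds adm wx wy; case: adm => _ /andP[t1 t2].
set u := slope q t x y in u1 u2 *.
rewrite (_ : _ + _ = ((1 - u) + t * a) * a); last by ring.
rewrite normrM ler_wpM2r //; apply: (le_trans (ler_normD _ _)).
have : `|t * a| <= t by rewrite normrM ger0_norm; [rewrite ler_piMr //; lra | lra].
have : `|1 - u| = u - 1 by rewrite ler0_norm; lra.
lra.
Qed.

Lemma phi_shift_r (q t x y a : R) : admissible q t -> left_window x -> right_window y -> `|a| <=
    1 ->
  `|phi q t x (y + a) - phi q t x y| <= 9 * `|a|.
Proof.
move=> adm wx wy a1; have := phi_shift q t x y 0 a; rewrite addr0 => ->.
have /andP[u1 u2] := slope_bounds adm wx wy; case: adm => _ /andP[t1 t2].
set u := slope q t x y in u1 u2 *.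
rewrite (_ : _ + _ = (u + t * a) * a); last by ring.
rewrite normrM ler_wpM2r //; apply: (le_trans (ler_normD _ _)).
have : `|t * a| <= t by rewrite normrM ger0_norm; [rewrite ler_piMr //; lra | lra].
have : `|u| = u by rewrite ger0_norm; lra.
lra.
Qed.

(** The gain comes from the smoothness of [h]: summation by parts in [x] for fixed [y], with [phi]
    Lipschitz of constant 9. The boundary terms give 128, twice the inverse of the window length. *)
Lemma pattern_sum_shift1 (W : nat) (s q t M L : R) (v : int) (F f1 h : R -> R) :
  admissible q t -> 0 < s -> W%:R * s = 1 / 64 -> `|v%:~R * s| <= 1 ->
  (forall z, `|F z| <= M) -> (forall z, `|f1 z| <= M) -> (forall z, `|h z| <= M) ->
  (forall z z', `|h z - h z'| <= L * `|z - z'|) ->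
  `|pattern_sum W s q t (fun z => F (z + v%:~R * s) - F z) f1 h| <=
  W%:R ^+ 2 * (`|v%:~R * s| * M ^+ 2 * (128 * M + 9 * L)).
Proof.
move=> adm s0 Ws vs FM f1M hM hL.
have M0 : 0 <= M by exact: le_trans (normr_ge0 _) (hM 0).
have L0 : 0 <= L by have := hL 1 0; rewrite subr0 normr1 mulr1; apply: le_trans (normr_ge0 _).
rewrite /pattern_sum exchange_big /=.
apply: (@le_trans _ _ (W%:R * (2 * `|v|%:~R * (M * (M * M)) +
    W%:R * (M * (M * (L * (9 * `|v%:~R * s|))))))).
  apply: norm_sum_const => j.
  under eq_bigr do rewrite -mulrA.
  apply: (@oscillating_sum W s (1 / 8) M (M * M) _ v F
    (fun z => f1 (3 / 8 + j%:R * s) * h (phi q t z (3 / 8 + j%:R * s)))) => //.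
  - by move=> z; rewrite normrM ler_pM.
  - move=> i; rewrite -mulrBr normrM ler_pM //; apply: (le_trans (hL _ _)).
    rewrite ler_wpM2l // phi_shift_l //.
      exact: (left_window_grid Ws (ltW s0) (ltnW (ltn_ord i))).
    exact: (right_window_grid Ws (ltW s0) (ltnW (ltn_ord j))).
rewrite normrM (gtr0_norm s0) -intr_norm; set V := `|v|%:~R.
have -> : 2 * V * (M * (M * M)) = W%:R * (128 * (V * s) * M ^+ 3).
  transitivity (128 * V * M ^+ 3 * (W%:R * s)); last by ring.
  by rewrite Ws; field.
by rewrite le_eqVlt; apply/orP; left; apply/eqP; ring.
Qed.

Lemma pattern_sum_shift2 (W : nat) (s q t M L : R) (v : int) (F f0 h : R -> R) :
  admissible q t -> 0 < s -> W%:R * s = 1 / 64 -> `|v%:~R * s| <= 1 ->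
  (forall z, `|F z| <= M) -> (forall z, `|f0 z| <= M) -> (forall z, `|h z| <= M) ->
  (forall z z', `|h z - h z'| <= L * `|z - z'|) ->
  `|pattern_sum W s q t f0 (fun z => F (z + v%:~R * s) - F z) h| <=
  W%:R ^+ 2 * (`|v%:~R * s| * M ^+ 2 * (128 * M + 9 * L)).
Proof.
move=> adm s0 Ws vs FM f0M hM hL.
have M0 : 0 <= M by exact: le_trans (normr_ge0 _) (hM 0).
have L0 : 0 <= L by have := hL 1 0; rewrite subr0 normr1 mulr1; apply: le_trans (normr_ge0 _).
rewrite /pattern_sum.
apply: (@le_trans _ _ (W%:R * (2 * `|v|%:~R * (M * (M * M)) +
    W%:R * (M * (M * (L * (9 * `|v%:~R * s|))))))).
  apply: norm_sum_const => i.
  under eq_bigr do rewrite (mulrC (f0 _)) -mulrA.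
  apply: (@oscillating_sum W s (3 / 8) M (M * M) _ v F
    (fun z => f0 (1 / 8 + i%:R * s) * h (phi q t (1 / 8 + i%:R * s) z))) => //.
  - by move=> z; rewrite normrM ler_pM.
  - move=> j; rewrite -mulrBr normrM ler_pM //; apply: (le_trans (hL _ _)).
    rewrite ler_wpM2l // phi_shift_r //.
      exact: (left_window_grid Ws (ltW s0) (ltnW (ltn_ord i))).
    exact: (right_window_grid Ws (ltW s0) (ltnW (ltn_ord j))).
rewrite normrM (gtr0_norm s0) -intr_norm; set V := `|v|%:~R.
have -> : 2 * V * (M * (M * M)) = W%:R * (128 * (V * s) * M ^+ 3).
  transitivity (128 * V * M ^+ 3 * (W%:R * s)); last by ring.
  by rewrite Ws; field.
by rewrite le_eqVlt; apply/orP; left; apply/eqP; ring.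
Qed.

End Telescoping.

(** * All three densities at once *)

Section Core.
Context {R : realType}.

Lemma half_gt0 (a : nat) : 0 < (1 / 2) ^+ a :> R.
Proof. by rewrite exprn_gt0 //; lra. Qed.

Lemma telescope (a : nat -> R) (B : R) (j n : nat) :
  (forall i, (i < n)%N -> `|a (j + i)%N - a (j + i.+1)%N| <= B) -> `|a j - a (j + n)%N| <= n%:R * B.
Proof.
elim: n => [|n IH] h; first by rewrite addn0 subrr normr0 mul0r.
rewrite -(subrKA (a (j + n)%N)); apply: (le_trans (ler_normD _ _)).
rewrite -[n.+1%:R]natr1 mulrDl mul1r lerD //; last exact: h.
by apply: IH => i iN; apply: h; exact: ltnW.
Qed.

Section FirstTwo.
Variables (n N K m : nat) (g q t : R) (f : nat -> R -> R).
Hypotheses (adm : admissible q t) (fm : mollified n g f) (g1 : 1 <= g) (Kn : (K <= n)%N).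
Hypotheses (KN : (K <= N)%N) (N6 : (6 <= N)%N) (mK : (48 * m + 48 <= K)%N).
Let M := 6 * g ^+ K.
Let s : R := (1 / 2) ^+ N.
Let PS := pattern_sum (2 ^ (N - 6)) s q t.
Let W2 : R := (2 ^ (N - 6))%N%:R ^+ 2.

Let M0 : 0 <= M.
Proof. by apply: mulr_ge0 => //; apply: exprn_ge0; exact: le_trans g1. Qed.

(** Since j < N, the step 2^(-j-1) is a multiple of the mesh. The third density, at scale 24 m, has
    a Lipschitz constant of order 2^(24 m), which the factor 2^(-48 m) of the shift more than
    compensates. *)
Let shift_small (j : nat) (sg : bool) : (48 * m <= j)%N -> (j < K)%N ->
  exists v : int, [/\ (-1) ^+ sg * (1 / 2) ^+ j.+1 = v%:~R * s, `|v%:~R * s| <= 1 &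
   W2 * (`|v%:~R * s| * M ^+ 2 * (128 * M + 9 * (M * 2 ^+ (24 * m)))) <=
   W2 * (2 ^+ 8 * M ^+ 3 * (1 / 2) ^+ m)].
Proof.
move=> mj jK; exists ((-1) ^+ sg * (2 ^ (N - j.+1))%N%:Z).
have E : (1 / 2) ^+ j.+1 = (2 ^ (N - j.+1))%N%:R * s :> R.
  rewrite /s -[in (1/2) ^+ N](subnK (_ : j.+1 <= N)%N); last by lia.
  rewrite exprD natrX mulrA -exprMn (_ : 2%:R * (1 / 2) = 1 :> R); last by field.
  by rewrite expr1n; ring.
have E' : (-1) ^+ sg * (1 / 2) ^+ j.+1 = ((-1) ^+ sg * (2 ^ (N - j.+1))%N%:Z)%:~R * s :> R.
  by rewrite intrM rmorphXn /= rmorphN1 E mulrA.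
rewrite -E' normrMsign (gtr0_norm (half_gt0 _)); split => //.
  by rewrite -[leRHS](expr0 (1 / 2)); exact: half_le.
apply: ler_wpM2l; first by rewrite exprn_ge0.
have h1 : 2 ^+ (24 * m) * (1 / 2) ^+ (48 * m) <= (1 / 2) ^+ m :> R.
  rewrite (_ : 48 * m = 24 * m + 24 * m)%N; last by lia.
  rewrite exprD mulrA -exprMn (_ : 2 * (1 / 2) = 1 :> R); last by field.
  by rewrite expr1n mulrC mulr1; apply: half_le; lia.
have h2 : 2 ^+ (24 * m) * (1 / 2) ^+ j.+1 <= (1 / 2) ^+ m :> R.
  apply: le_trans h1; rewrite ler_wpM2l ?exprn_ge0 //; apply: half_le; lia.
have h3 : 128 * M + 9 * (M * 2 ^+ (24 * m)) <= 2 ^+ 8 * M * 2 ^+ (24 * m).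
  have : M <= M * 2 ^+ (24 * m) by rewrite ler_peMr // exprn_ege1 // ler1n.
  rewrite (_ : 2 ^+ 8 = 256 :> R); last by rewrite -natrX.
  have : 0 <= M * 2 ^+ (24 * m) by rewrite mulr_ge0 // exprn_ge0.
  lra.
apply: (@le_trans _ _ ((1 / 2) ^+ j.+1 * M ^+ 2 * (2 ^+ 8 * M * 2 ^+ (24 * m)))).
  apply: ler_wpM2l => //; rewrite mulr_ge0 ?exprn_ge0 //; exact: ltW (half_gt0 1).
have -> : (1 / 2) ^+ j.+1 * M ^+ 2 * (2 ^+ 8 * M * 2 ^+ (24 * m)) =
    2 ^+ 8 * M ^+ 3 * (2 ^+ (24 * m) * (1 / 2) ^+ j.+1) by ring.
by rewrite ler_wpM2l // mulr_ge0 // exprn_ge0.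
Qed.

Let fMK k z : (k <= K)%N -> `|f k z| <= M.
Proof. by move=> kK; exact: mollified_bound fm g1 kK Kn. Qed.

Let WS : (2 ^ (N - 6))%N%:R * s = 1 / 64.
Proof. exact: grid_size. Qed.

Lemma first_step (f1 : R -> R) (j : nat) : (forall z, `|f1 z| <= M) ->
  (48 * m <= j)%N -> (j < K)%N ->
  `|PS (f j) f1 (f (24 * m)%N) - PS (f j.+1) f1 (f (24 * m)%N)| <=
      W2 * (2 ^+ 7 * M ^+ 3 * (1 / 2) ^+ m).
Proof.
move=> f1M mj jK.
have osc (sg : bool) (e : R) : (-1) ^+ sg * (1 / 2) ^+ j.+1 = e ->
    `|PS (fun z => f j.+1 (z + e) - f j.+1 z) f1 (f (24 * m)%N)|
    <= W2 * (2 ^+ 8 * M ^+ 3 * (1 / 2) ^+ m).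
  move=> <-; have [v [-> v1 vb]] := shift_small sg mj jK; apply: le_trans vb.
  apply: pattern_sum_shift1 => //.
  - exact: half_gt0.
  - by move=> z; exact: fMK.
  - by move=> z; apply: fMK; lia.
  - by move=> z z'; apply: mollified_Lipschitz fm g1 _ Kn; lia.
have h0 := osc false _ (mul1r _); have h1 := osc true _ (mulN1r _).
have -> : W2 * (2 ^+ 7 * M ^+ 3 * (1 / 2) ^+ m) = 1 / 2 * (W2 * (2 ^+ 8 * M ^+ 3 * (1 / 2) ^+ m)).
  by rewrite (exprS 2 7); field.
apply: le_trans (quarters h0 h1); rewrite le_eqVlt; apply/orP; left; apply/eqP; congr `|_|.
rewrite /PS /pattern_sum -sumrB !mulr_sumr -big_split; apply: eq_bigr => i _ /=.
rewrite -sumrB !mulr_sumr -big_split; apply: eq_bigr => k _ /=.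
rewrite -!mulrBl (mollified_step j _ fm); ring.
Qed.

Lemma second_step (f0 : R -> R) (j : nat) : (forall z, `|f0 z| <= M) ->
  (48 * m <= j)%N -> (j < K)%N ->
  `|PS f0 (f j) (f (24 * m)%N) - PS f0 (f j.+1) (f (24 * m)%N)| <=
      W2 * (2 ^+ 7 * M ^+ 3 * (1 / 2) ^+ m).
Proof.
move=> f0M mj jK.
have osc (sg : bool) (e : R) : (-1) ^+ sg * (1 / 2) ^+ j.+1 = e ->
    `|PS f0 (fun z => f j.+1 (z + e) - f j.+1 z) (f (24 * m)%N)|
    <= W2 * (2 ^+ 8 * M ^+ 3 * (1 / 2) ^+ m).
  move=> <-; have [v [-> v1 vb]] := shift_small sg mj jK; apply: le_trans vb.
  apply: pattern_sum_shift2 => //.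
  - exact: half_gt0.
  - by move=> z; exact: fMK.
  - by move=> z; apply: fMK; lia.
  - by move=> z z'; apply: mollified_Lipschitz fm g1 _ Kn; lia.
have h0 := osc false _ (mul1r _); have h1 := osc true _ (mulN1r _).
have -> : W2 * (2 ^+ 7 * M ^+ 3 * (1 / 2) ^+ m) = 1 / 2 * (W2 * (2 ^+ 8 * M ^+ 3 * (1 / 2) ^+ m)).
  by rewrite (exprS 2 7); field.
apply: le_trans (quarters h0 h1); rewrite le_eqVlt; apply/orP; left; apply/eqP; congr `|_|.
rewrite /PS /pattern_sum -sumrB !mulr_sumr -big_split; apply: eq_bigr => i _ /=.
rewrite -sumrB !mulr_sumr -big_split; apply: eq_bigr => k _ /=.
rewrite -!mulrBl -!mulrBr (mollified_step j _ fm); ring.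
Qed.

(* The third density is first replaced by one at a much coarser scale, by the
   smoothing estimate; an oscillation of the first or the second density is then
   summed against a function that hardly varies. *)
Lemma cube_step : (0 < m)%N -> (56 * (m + 1) <= N)%N -> K = (48 * m + 48)%N ->
  `|PS (f (48 * m)%N) (f (48 * m)%N) (f (48 * m)%N) -
    PS (f (48 * m + 48)%N) (f (48 * m + 48)%N) (f (48 * m + 48)%N)| <=
  W2 * (2 ^+ 17 * M ^+ 3 * (1 / 2) ^+ m).
Proof.
move=> m0 mN EK.
pose F := f (48 * m)%N; pose G := f (48 * m + 48)%N; pose h := f (24 * m)%N.
have FM z : `|F z| <= M by apply: fMK; lia.
have GM z : `|G z| <= M by apply: fMK; lia.
(* [b = m] leads from [h] to the scale of [F], and [b = m + 2] to that of [G]. *)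
have third (H : R -> R) (b : nat) : (forall z, `|H z| <= M) -> (b <= m + 2)%N ->
    `|PS H H h - PS H H (f (24 * (m + b))%N)| <= W2 * (2 ^+ 15 * M ^+ 3 * (1 / 2) ^+ m).
  move=> HM bm.
  have := third_telescope (N := N) adm fm g1 Kn HM HM (a := m) (m := b) m0 ltac:(lia) ltac:(lia).
  move/le_trans; apply; apply: ler_wpM2l; first by rewrite exprn_ge0.
  apply: ler_wpM2l; first by rewrite mulr_ge0 ?exprn_ge0.
  by rewrite gerBl ltW.
have t1 := third F m FM ltac:(lia).
have t4 := third G (m + 2)%N GM ltac:(lia).
rewrite (_ : 24 * (m + m) = 48 * m)%N in t1; last lia.
rewrite (_ : 24 * (m + (m + 2)) = 48 * m + 48)%N in t4; last lia.
have t2 : `|PS F F h - PS G F h| <= 48%:R * (W2 * (2 ^+ 7 * M ^+ 3 * (1 / 2) ^+ m)).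
  apply: (@telescope (fun j => PS (f j) F h)) => i i48; rewrite addnS; apply: first_step => //; lia.
have t3 : `|PS G F h - PS G G h| <= 48%:R * (W2 * (2 ^+ 7 * M ^+ 3 * (1 / 2) ^+ m)).
  apply: (@telescope (fun j => PS G (f j) h)) => i i48; rewrite addnS; apply: second_step => //;
      lia.
rewrite -/F -/G in t1 t4 *.
pose X := W2 * (2 ^+ 7 * M ^+ 3 * (1 / 2) ^+ m).
have X0 : 0 <= X.
  have W0 : 0 <= W2 by rewrite /W2 exprn_ge0.
  apply: mulr_ge0 => //; apply: mulr_ge0; last exact: ltW.
  by rewrite mulr_ge0 ?exprn_ge0.
have E15 : W2 * (2 ^+ 15 * M ^+ 3 * (1 / 2) ^+ m) = 256 * X by rewrite /X; ring.
have -> : W2 * (2 ^+ 17 * M ^+ 3 * (1 / 2) ^+ m) = 1024 * X by rewrite /X; ring.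
rewrite E15 in t1 t4; rewrite -/X in t2 t3.
(* The path from F F F to G G G passes through F F h, G F h and G G h. Its pieces cost 256 X, 48 X,
   48 X and 256 X, less than 1024 X together. *)
rewrite (_ : _ - _ = - (PS F F h - PS F F F) + (PS F F h - PS G F h) + (PS G F h - PS G G h) +
    (PS G G h - PS G G G)); last by ring.
apply: (le_trans (ler_normD _ _)).
apply: (le_trans (lerD (ler_normD _ _) (lexx _))).
apply: (le_trans (lerD (lerD (ler_normD _ _) (lexx _)) (lexx _))).
rewrite normrN; lra.
Qed.

End FirstTwo.

Lemma pattern_sum_ge (W : nat) (s q t c : R) (F : R -> R) :
  admissible q t -> 0 <= s -> W%:R * s = 1 / 64 -> 0 <= c -> (forall z, 0 < z < 1 -> c <= F z) ->
  W%:R ^+ 2 * c ^+ 3 <= pattern_sum W s q t F F F.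
Proof.
move=> adm s0 Ws c0 Fc.
apply: (@le_trans _ _ (\sum_(i < W) \sum_(j < W) c ^+ 3)).
  by rewrite !sumr_const !card_ord -mulrnA -[leRHS]mulr_natl natrM expr2.
apply: ler_sum => i _; apply: ler_sum => j _.
have wi := left_window_grid Ws s0 (ltnW (ltn_ord i)).
have wj := right_window_grid Ws s0 (ltnW (ltn_ord j)).
have p := phi_window adm wi wj.
rewrite !exprS expr0 mulr1 mulrA; apply: ler_pM => //.
- exact: mulr_ge0.
- apply: ler_pM => //; apply: Fc.
  + by move: wi; rewrite /left_window; lra.
  + by move: wj; rewrite /right_window; lra.
- exact: Fc.
Qed.

Lemma pattern_sum_gt0 (W : nat) (s q t : R) (F : R -> R) :
  0 <= s -> W%:R * s = 1 / 64 -> (forall z, 0 <= F z) ->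
  0 < pattern_sum W s q t F F F ->
  exists x y, [/\ left_window x, right_window y, 0 < F x, 0 < F y & 0 < F (phi q t x y)].
Proof.
move=> s0 Ws F0 P0; apply: contrapT => nE; move: P0.
rewrite /pattern_sum big1 ?ltxx // => i _; rewrite big1 // => j _.
apply: contrapT => /eqP; rewrite !mulf_eq0 !negb_or => /andP[/andP[h1 h2] h3]; apply: nE.
exists (1 / 8 + i%:R * s), (3 / 8 + j%:R * s); split.
- exact: (left_window_grid Ws s0 (ltnW (ltn_ord i))).
- exact: (right_window_grid Ws s0 (ltnW (ltn_ord j))).
- by rewrite lt_def h1 F0.
- by rewrite lt_def h2 F0.
- by rewrite lt_def h3 F0.
Qed.

(** The bound [6 * g ^+ (48 * k + 48)] on the densities, cubed, is at most 216 (9/8)^(k+1); together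
    with the gain 2^(-k) this is 243 (9/16)^k. *)
Lemma cube_geometric (N m k : nat) (g q t : R) (f : nat -> R -> R)
    (b := fun j => pattern_sum (2 ^ (N - 6)) ((1 / 2) ^+ N) q t (f (48 * j)%N) (f (48 *
        j)%N) (f (48 * j)%N)) :
  (0 < k)%N -> (k < m)%N -> (56 * (m + 1) <= N)%N -> 1 <= g -> g ^+ 144 <= 9 / 8 ->
  admissible q t -> mollified (48 * m) g f ->
  b k - b k.+1 <= (2 ^ (N - 6))%N%:R ^+ 2 * (2 ^+ 17 * (243 * (9 / 16) ^+ k)).
Proof.
move=> k0 km mN g1 g144 adm fm.
have Kn : (48 * k + 48 <= 48 * m)%N by lia.
have KN : (48 * k + 48 <= N)%N by lia.
have N6 : (6 <= N)%N by lia.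
have kN : (56 * (k + 1) <= N)%N by lia.
have E48 : (48 * k + 48 = 48 * k.+1)%N by lia.
have E3 : (48 * k.+1 * 3 = 144 * k.+1)%N by lia.
have := cube_step adm fm g1 Kn KN N6 (leqnn _) k0 kN erefl.
rewrite E48 => step; apply: (le_trans (ler_norm _)); apply: (le_trans step).
apply: ler_wpM2l; first by rewrite exprn_ge0.
rewrite -mulrA; apply: ler_wpM2l; first by rewrite exprn_ge0.
rewrite exprMn -exprM E3 exprM.
have h : (g ^+ 144) ^+ k.+1 <= (9 / 8) ^+ k.+1.
  rewrite lerXn2r // nnegrE; last by rewrite divr_ge0.
  by rewrite exprn_ge0 // (le_trans _ g1).
apply: (@le_trans _ _ (6 ^+ 3 * (9 / 8) ^+ k.+1 * (1 / 2) ^+ k)).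
  apply: ler_wpM2r; first by rewrite exprn_ge0 // divr_ge0.
  by apply: ler_wpM2l => //; rewrite exprn_ge0.
have -> : 9 / 16 = 9 / 8 * (1 / 2) :> R by field.
rewrite [(9 / 8) ^+ _.+1]exprS [in leRHS]exprMn.
by rewrite le_eqVlt; apply/orP; left; apply/eqP; field.
Qed.

(** The initial average, at least (1/8)^3, must survive a geometric tail that starts at [m0] and has
    absolute constants. Hence [m0] precedes [g] and the densities, and the exponent can be adapted
    to it later. *)
Lemma mollified_pattern : exists m0 : nat, (0 < m0)%N /\
  forall (m : nat) (g q t : R) (f : nat -> R -> R),
  (m0 <= m)%N -> 1 <= g -> g ^+ 144 <= 9 / 8 -> admissible q t -> mollified (48 * m) g f ->
  (forall z, 0 < z < 1 -> 1 / 8 <= f (48 * m0)%N z) ->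
  exists x y, [/\ left_window x, right_window y, 0 < f (48 * m)%N x, 0 < f (48 * m)%N y &
    0 < f (48 * m)%N (phi q t x y)].
Proof.
(* From [m0] on, the series of 243 (9/16)^k sums to 243 * 16/7 times (9/16)^m0, and 243 * 16/7 <
   600. *)
pose C : R := 2 ^+ 17 * 600.
have C0 : 0 < C by apply: mulr_gt0; [exact: exprn_gt0 | rewrite ltr0n].
have CE : C = 2 ^+ 17 * 600 by [].
clearbody C.
have : exists m0 : nat, (0 < m0)%N /\ C * (9 / 16) ^+ m0 < 1 / 512.
  have a1 : `|9 / 16 : R| < 1 by rewrite ger0_norm; lra.
  have d0 : 0 < 1 / 512 / C by apply: divr_gt0; [lra | exact: C0].
  have /cvgrPdist_lt /(_ _ d0) [n _ hn] := cvg_expr a1.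
  exists n.+1; split => //.
  have := hn n.+1 (leqnSn _); rewrite /= sub0r normrN normrX ger0_norm; last lra.
  by rewrite ltr_pdivlMr // mulrC.
move=> [m0 [m00 hm0]]; exists m0; split => // m g q t f m0m g1 g144 adm fm fbig.
pose N := (56 * (m + 1))%N; pose s : R := (1 / 2) ^+ N.
pose PS := pattern_sum (2 ^ (N - 6)) s q t.
pose b k := PS (f (48 * k)%N) (f (48 * k)%N) (f (48 * k)%N).
pose W2 : R := (2 ^ (N - 6))%N%:R ^+ 2.
have W20 : 0 < W2 by rewrite exprn_gt0 // ltr0n expn_gt0.
have N6 : (6 <= N)%N by lia.
have WS : (2 ^ (N - 6))%N%:R * s = 1 / 64 by exact: grid_size.
have s0 : 0 <= s by rewrite exprn_ge0 //; lra.
have main k : (m0 + k <= m)%N ->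
    W2 * (1 / 512 - C * ((9 / 16) ^+ m0 - (9 / 16) ^+ (m0 + k))) <= b (m0 + k)%N.
  elim: k => [|k IH] kM.
    rewrite addn0 subrr mulr0 subr0.
    have -> : 1 / 512 = (1 / 8) ^+ 3 :> R by field.
    by apply: pattern_sum_ge => //; lra.
  have km : (m0 + k < m)%N by rewrite -addnS.
  have {}IH := IH (ltnW km).
  have k0 : (0 < m0 + k)%N by rewrite addn_gt0 m00.
  have step := cube_geometric k0 km (leqnn _) g1 g144 adm fm.
  rewrite -/(b (m0 + k)%N) -/(b (m0 + k).+1) -/W2 in step.
  rewrite addnS [(9 / 16) ^+ _.+1]exprS; set Q : R := (9 / 16) ^+ (m0 + k) in IH step *.
  have Q0 : 0 <= Q by rewrite exprn_ge0 // divr_ge0.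
  have {}step : b (m0 + k)%N - b (m0 + k).+1 <= W2 * (C * (7 / 16) * Q).
    apply: (le_trans step); apply: ler_wpM2l; first exact: ltW.
    have -> : C * (7 / 16) * Q = 2 ^+ 17 * (600 * (7 / 16) * Q) by rewrite CE !mulrA.
    apply: (ler_wpM2l (exprn_ge0 17 (ler0n R 2))).
    clear -Q0; lra.
  have -> : W2 * (1 / 512 - C * ((9 / 16) ^+ m0 - 9 / 16 * Q)) =
     W2 * (1 / 512 - C * ((9 / 16) ^+ m0 - Q)) - W2 * (C * (7 / 16) * Q) by field.
  by apply: (le_trans (lerB IH step)); rewrite opprB addrC subrK.
have := main (m - m0)%N; rewrite subnKC // => /(_ (leqnn _)) bm.
case: (fm) => f0 _ _ _.
apply: (pattern_sum_gt0 s0 WS (f0 _)).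
apply: lt_le_trans bm; apply: mulr_gt0; first exact: W20.
rewrite subr_gt0.
apply: le_lt_trans hm0; apply: ler_wpM2l; first exact: ltW.
by rewrite gerBl exprn_ge0 // divr_ge0.
Qed.

End Core.

(** * Densities of atomic measures *)

Section Atoms.
Context {R : realType}.

Definition tent (u : R) : R := Num.max 0 (1 - `|u|).

Lemma tent_cases (u : R) : (`|u| < 1 /\ tent u = 1 - `|u|) \/ (1 <= `|u| /\ tent u = 0).
Proof.
rewrite /tent; case: (ltP `|u| 1) => h; [left | right]; split => //.
  by apply/max_idPr; lra.
by apply/max_idPl; lra.
Qed.

Lemma tent_ge0 (u : R) : 0 <= tent u.
Proof. by rewrite /tent le_max lexx. Qed.

Lemma tent_refine (u : R) :
  tent u = 1 / 2 * tent (2 * u - 1) + tent (2 * u) + 1 / 2 * tent (2 * u + 1).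
Proof.
have tz (v : R) : 1 <= v \/ v <= -1 -> tent v = 0.
  move=> h; case: (tent_cases v) => -[hv ->] //; have := ler_norm v; have := ler_norm (- v).
  by rewrite normrN; case: h; lra.
have tp (v : R) : 0 <= v -> v <= 1 -> tent v = 1 - v.
  by move=> h0 h1; case: (tent_cases v) => -[]; rewrite (ger0_norm h0) => ? ->; lra.
have tn (v : R) : v <= 0 -> -1 <= v -> tent v = 1 + v.
  by move=> h0 h1; case: (tent_cases v) => -[]; rewrite (ler0_norm h0) => ? ->; lra.
have [h1|h1] := lerP u (-1).
  by rewrite !tz; [lra | right; lra | right; lra | right; lra | right; lra].
have [h2|h2] := lerP 1 u.
  by rewrite !tz; [lra | left; lra | left; lra | left; lra | left; lra].
have [h0|h0] := lerP 0 u.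
  have [h3|h3] := lerP u (1 / 2).
    by rewrite (tp u) ?(tp (2 * u)) ?(tn (2 * u - 1)) ?(tz (2 * u + 1)); try (left; lra); lra.
  by rewrite (tp u) ?(tz (2 * u)) ?(tp (2 * u - 1)) ?(tz (2 * u + 1)); try (left; lra); lra.
have [h3|h3] := lerP u (- (1 / 2)).
  by rewrite (tn u) ?(tz (2 * u)) ?(tz (2 * u - 1)) ?(tn (2 * u + 1)); try (right; lra); lra.
by rewrite (tn u) ?(tn (2 * u)) ?(tz (2 * u - 1)) ?(tp (2 * u + 1)); try (right; lra); lra.
Qed.

(** An entry of [s] is a position and a mass. This is the convolution of the atomic measure with the
    hat function of half-width 2^(-k) and integral 1. *)
Definition atom_density (s : seq (R * R)) (k : nat) (z : R) : R :=
  \sum_(a <- s) a.2 * (2 ^+ k * tent (2 ^+ k * (z - a.1))).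

Definition cell_index (k : nat) (x : R) : int := Num.floor (2 ^+ k * x).

Definition cell_mass (s : seq (R * R)) (k : nat) (i : int) : R :=
  \sum_(a <- s | cell_index k a.1 == i) a.2.

Lemma floor_near (u v : R) : `|u - v| < 1 ->
  [|| Num.floor v == Num.floor u - 1, Num.floor v == Num.floor u | Num.floor v == Num.floor u + 1].
Proof.
have /andP[a b] := floor_itv u; have /andP[c d] := floor_itv v.
rewrite ltr_distl => /andP[e f].
have h1 : Num.floor u - 1 <= Num.floor v.
  by rewrite -ltzD1 -(ltr_int R); move: d; rewrite !(intrD, intrB); lra.
have h2 : Num.floor v <= Num.floor u + 1.
  by rewrite -ltzD1 -(ltr_int R); move: b; rewrite !(intrD, intrB); lra.
lia.
Qed.

Section Bounds.
Variables (n : nat) (w : R) (s : seq (R * R)).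
Hypotheses (w0 : 0 <= w) (s0 : forall a, a \in s -> 0 <= a.2).
Hypothesis sw : forall k i, (k <= n)%N -> cell_mass s k i <= w ^+ k.

Lemma near_mass (k : nat) (z : R) : (k <= n)%N ->
  \sum_(a <- s) a.2 * (`|2 ^+ k * (z - a.1)| < 1)%R%:R <= 3 * w ^+ k.
Proof.
move=> kn; pose i := cell_index k z.
apply: (@le_trans _ _ (cell_mass s k (i - 1) + cell_mass s k i + cell_mass s k (i + 1)));
    last first.
  by have := sw (i - 1) kn; have := sw i kn; have := sw (i + 1) kn; lra.
rewrite /cell_mass !(big_mkcond (fun a => cell_index k a.1 == _)) -!big_split /=.
rewrite [leLHS]big_seq [leRHS]big_seq; apply: ler_sum => a /s0 a0.
case: ltP => h; last first.
  by rewrite mulr0 !addr_ge0 //; case: ifP.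
rewrite mulr1; rewrite mulrBr in h.
have := floor_near h; rewrite -/(cell_index k z) -/(cell_index k a.1) -/i => /or3P[]/eqP ->.
- by rewrite eqxx; case: eqP; case: eqP => *; lra.
- by rewrite eqxx; case: eqP; case: eqP => *; lra.
- by rewrite eqxx; case: eqP; case: eqP => *; lra.
Qed.

Lemma atom_density_mollified : mollified n (2 * w) (atom_density s).
Proof.
have p2 k : 0 < 2 ^+ k :> R by rewrite exprn_gt0.
split.
- move=> k z; rewrite /atom_density big_seq; apply: sumr_ge0 => a /s0 a0.
  by rewrite !mulr_ge0 ?tent_ge0 // ltW.
- move=> k z kn; apply: (@le_trans _ _ (2 ^+ k * (3 * w ^+ k))); last first.
    rewrite exprMn; have : 0 <= 2 ^+ k * w ^+ k by rewrite mulr_ge0 ?exprn_ge0.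
    lra.
  apply: le_trans (ler_wpM2l (ltW (p2 k)) (near_mass z kn)).
  rewrite mulr_sumr /atom_density [leLHS]big_seq [leRHS]big_seq; apply: ler_sum => a /s0 a0.
  rewrite [leRHS]mulrCA; apply: ler_wpM2l => //; rewrite ler_pM2l //.
  case: (tent_cases (2 ^+ k * (z - a.1))) => -[h ->]; first by rewrite h gerBl.
  by rewrite ltNge h.
- move=> k z z' kn; rewrite /atom_density -sumrB.
  apply: (@le_trans _ _ (2 ^+ k * 2 ^+ k * `|z - z'| * (3 * w ^+ k + 3 * w ^+ k))); last first.
    by rewrite exprMn le_eqVlt; apply/orP; left; apply/eqP; ring.
  have c0 : 0 <= 2 ^+ k * 2 ^+ k * `|z - z'| by rewrite !mulr_ge0 // ltW.
  apply: le_trans (ler_wpM2l c0 (lerD (near_mass z kn) (near_mass z' kn))).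
  rewrite -big_split mulr_sumr; apply: (le_trans (ler_norm_sum _ _ _)).
  rewrite [leLHS]big_seq [leRHS]big_seq; apply: ler_sum => a /s0 a0 /=.
  rewrite -mulrBr normrM (ger0_norm a0) -mulrDr [leRHS]mulrCA; apply: ler_wpM2l => //.
  rewrite -mulrBr normrM gtr0_norm // -!mulrA; apply: ler_wpM2l; first exact: ltW.
  have : `| (`|2 ^+ k * (z - a.1)|) - (`|2 ^+ k * (z' - a.1)|) | <= 2 ^+ k * `|z - z'|.
    apply: (le_trans (ler_dist_dist _ _)).
    by rewrite -mulrBr normrM gtr0_norm // opprB addrA subrK.
  rewrite mulrA; set D : R := 2 ^+ k * `|z - z'|.
  have aux (x y d : R) : `|x - y| <= d -> `|(1 - x) - (1 - y)| <= d /\ 1 - x <=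
      1 - y + d /\ 1 - y <= 1 - x + d.
    by rewrite !ler_norml => /andP[? ?]; split; [apply/andP; split; lra | split; lra].
  move=> /aux[d0 [d1 d2]]; have D0 : 0 <= D by apply: le_trans d0.
  case: (tent_cases (2 ^+ k * (z - a.1))) => -[h ->];
  case: (tent_cases (2 ^+ k * (z' - a.1))) => -[h' ->].
  + by rewrite h h'; apply: (le_trans d0); rewrite mulrDr mulr1 lerDl.
  + rewrite h (le_gtF h'); apply: (@le_trans _ _ D); last by rewrite addr0 mulr1.
    rewrite subr0 ger0_norm ?subr_ge0 ?(ltW h) //.
    by apply: (le_trans d1); rewrite gerDr subr_le0.
  + rewrite h' (le_gtF h); apply: (@le_trans _ _ D); last by rewrite add0r mulr1.
    rewrite sub0r normrN ger0_norm ?subr_ge0 ?(ltW h') //.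
    by apply: (le_trans d2); rewrite gerDr subr_le0.
  + by rewrite (le_gtF h) (le_gtF h') /= addr0 mulr0 subrr normr0.
- move=> k z; rewrite /atom_density !mulr_sumr -!big_split; apply: eq_bigr => a _ /=.
  have E (x : R) : 2 ^+ k.+1 * (x - a.1) = 2 * (2 ^+ k * (x - a.1)) by rewrite exprS mulrA.
  have h2 : 2 ^+ k * (1 / 2) ^+ k.+1 = 1 / 2 :> R.
    rewrite exprS mulrCA -exprMn (_ : 2 * (1 / 2) = 1 :> R); last by field.
    by rewrite expr1n mulr1.
  rewrite !E (tent_refine (2 ^+ k * (z - a.1))).
  have -> : 2 * (2 ^+ k * (z - (1 / 2) ^+ k.+1 - a.1)) = 2 * (2 ^+ k * (z - a.1)) - 1.
    transitivity (2 * (2 ^+ k * (z - a.1)) - 2 * (2 ^+ k * (1 / 2) ^+ k.+1)); first by ring.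
    by rewrite h2; field.
  have -> : 2 * (2 ^+ k * (z + (1 / 2) ^+ k.+1 - a.1)) = 2 * (2 ^+ k * (z - a.1)) + 1.
    transitivity (2 * (2 ^+ k * (z - a.1)) + 2 * (2 ^+ k * (1 / 2) ^+ k.+1)); first by ring.
    by rewrite h2; field.
  by rewrite exprS; field.
Qed.

(** When the total mass is nearly full and no cell holds much more than its share, no cell is nearly
    empty: the one of [z] holds what the others leave. Level [k.+1] is taken because the kernel of
    level [k] is at least half its maximum on the whole cell of [z]. *)
Lemma atom_density_ge (k : nat) (c z : R) : (k.+1 <= n)%N ->
  (forall a, a \in s -> 0 <= a.1 < 1) -> c <= \sum_(a <- s) a.2 -> 0 <= z < 1 ->
  1 / (2 * 2 ^+ k.+1) <= c - (2 ^+ k.+1 - 1) * w ^+ k.+1 -> 1 / 8 <= atom_density s k z.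
Proof.
move=> kn s1 hc hz hw; pose G := (2 ^ k.+1)%N.
have EG : G%:R = 2 ^+ k.+1 :> R by rewrite natrX.
have idx x : 0 <= x < 1 -> exists i : 'I_G, cell_index k.+1 x = i%:Z.
  move=> /andP[x0 x1]; have h0 : 0 <= cell_index k.+1 x.
    by rewrite /cell_index floor_ge0 mulr_ge0 // exprn_ge0.
  have h1 : cell_index k.+1 x < G%:Z.
    rewrite /cell_index floor_lt_int -pmulrn EG -[ltRHS]mulr1 ltr_pM2l // exprn_gt0 //.
  have h2 : (`|cell_index k.+1 x| < G)%N by lia.
  by exists (Ordinal h2) => /=; lia.
have [i0 hi0] := idx z hz.
have tot : \sum_(a <- s) a.2 = \sum_(i < G) cell_mass s k.+1 i%:Z.
  rewrite /cell_mass; under [RHS]eq_bigr do rewrite big_mkcond.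
  rewrite exchange_big /=; rewrite [LHS]big_seq [RHS]big_seq; apply: eq_bigr => a /s1 /idx[i hi].
  rewrite (bigD1 i) //= hi eqxx big1 ?addr0 // => j ji; case: eqP => // -[E].
  by move: ji; rewrite -val_eqE /= E eqxx.
have big_cell : 1 / (2 * 2 ^+ k.+1) <= cell_mass s k.+1 i0%:Z.
  move: hc; rewrite tot (bigD1 i0) //= => hc.
  have : \sum_(i < G | i != i0) cell_mass s k.+1 i%:Z <= (2 ^+ k.+1 - 1) * w ^+ k.+1.
    apply: (@le_trans _ _ (\sum_(i < G | i != i0) w ^+ k.+1)).
      by apply: ler_sum => i _; exact: sw.
    rewrite sumr_const cardC1 card_ord -[leLHS]mulr_natl -EG.
    by rewrite -subn1 natrB ?expn_gt0.
  lra.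
have lower : 2 ^+ k * (1 / 2) * cell_mass s k.+1 i0%:Z <= atom_density s k z.
  rewrite /cell_mass /atom_density mulr_sumr big_mkcond /= [leLHS]big_seq [leRHS]big_seq.
  apply: ler_sum => a /s0 a0; case: eqP => [E|_]; last first.
    by rewrite !mulr_ge0 ?tent_ge0 // exprn_ge0.
  rewrite [leLHS]mulrC; apply: ler_wpM2l => //; rewrite ler_pM2l ?exprn_gt0 //.
  have /andP[h1 h2] := floor_itv (2 ^+ k.+1 * z); have /andP[h3 h4] := floor_itv (2 ^+ k.+1 * a.1).
  rewrite -/(cell_index _ _) hi0 in h1 h2; rewrite -/(cell_index _ _) E in h3 h4.
  have : `|2 ^+ k.+1 * z - 2 ^+ k.+1 * a.1| < 1.
    by rewrite ltr_distl; move: h2 h4; rewrite intrD => h2 h4; apply/andP; split; lra.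
  rewrite -mulrBr exprS -mulrA normrM (@ger0_norm _ 2) // => h.
  case: (tent_cases (2 ^+ k * (z - a.1))) => -[h' ->]; lra.
apply: le_trans lower.
have p2 : 0 < 2 ^+ k :> R by rewrite exprn_gt0.
apply: (@le_trans _ _ (2 ^+ k * (1 / 2) * (1 / (2 * 2 ^+ k.+1)))).
  rewrite exprS le_eqVlt; apply/orP; left; apply/eqP; field; exact: lt0r_neq0.
rewrite ler_wpM2l //; rewrite mulr_ge0 ?(ltW p2) //; lra.
Qed.

End Bounds.

Lemma atom_density_gt0 (s : seq (R * R)) (k : nat) (z : R) : 0 < atom_density s k z ->
  exists2 a, a \in s & `|z - a.1| < (1 / 2) ^+ k.
Proof.
move=> f0; apply: contrapT => nE; move: f0.
rewrite /atom_density big_seq big1 ?ltxx // => a sa.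
case: (tent_cases (2 ^+ k * (z - a.1))) => -[h ->]; last by rewrite !mulr0.
exfalso; apply: nE; exists a => //; move: h; rewrite normrM ger0_norm ?exprn_ge0 //.
by rewrite -ltr_pdivlMl ?exprn_gt0 // mulr1 !mul1r exprVn.
Qed.

(** Through this reflection one estimate serves both signs of the configuration value. *)
Lemma mollified_mirror n g (f : nat -> R -> R) : mollified n g f ->
  mollified n g (fun k z => f k (1 - z)).
Proof.
case=> h1 h2 h3 h4; split => //.
- by move=> k z kn; exact: h2.
- move=> k z z' kn; apply: (le_trans (h3 k _ _ kn)).
  by rewrite (_ : 1 - z - (1 - z') = - (z - z')) ?normrN //; ring.
- move=> k z; rewrite h4 (_ : 1 - (z - _) = 1 - z + (1 / 2) ^+ k.+1); last by ring.
  by rewrite (_ : 1 - (z + _) = 1 - z - (1 / 2) ^+ k.+1); [ring | ring].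
Qed.

End Atoms.

(** * Dyadic content *)

Local Open Scope classical_set_scope.
Local Open Scope ring_scope.

Section ExtendedSums.
Context {R : realType} {T : choiceType}.
Local Open Scope ereal_scope.

Lemma esum_subset (A B : set T) (a : T -> \bar R) : A `<=` B -> esum A a <= esum B a.
Proof.
move=> AB; apply: ereal_sup_le => _ [X [fX XA] <-]; exists X => //.
by split => //; exact: subset_trans AB.
Qed.

End ExtendedSums.

Section ExtendedSums2.
Context {R : realType} {T : choiceType}.
Local Open Scope ereal_scope.

Lemma esum_scale_le (A : set T) (a : T -> \bar R) (c : R) : (0 <= c)%R ->
  (forall i, 0 <= a i) -> esum A (fun i => c%:E * a i) <= c%:E * esum A a.
Proof.
move=> c0 a0; apply: ge_ereal_sup => _ [X [fX XA] <-].
rewrite -ge0_mule_fsumr //; apply: lee_wpmul2l; first by rewrite lee_fin.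
by apply: ereal_sup_ubound; exists X.
Qed.

(** Choosing an index for each element of the union embeds it in the disjoint sum of the family. *)
Lemma esum_bigcup_le (S : set T) (F : T -> set T) (a : T -> \bar R) :
  (forall i, 0 <= a i) ->
  esum (\bigcup_(i in S) F i) a <= esum S (fun i => esum (F i) a).
Proof.
move=> a0.
have /boolp.choice [p hp] : forall q, exists i, (\bigcup_(i in S) F i) q -> S i /\ F i q.
  move=> q; have [[i Si Fiq]|nq] := pselect ((\bigcup_(i in S) F i) q).
    by exists i.
  by exists q.
rewrite (@esum_esum _ _ _ S F (fun _ j => a j)) //.
set A := \bigcup_(i in S) F i in hp *.
have -> : esum A a = esum ((fun q => (p q, q)) @` A) (fun k => a k.2).
  by rewrite esum_image // => x y _ _ [].
by apply: esum_subset => _ [q /hp[Sp Fq] <-].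
Qed.

End ExtendedSums2.

Section Cells.
Context {R : realType}.

Lemma cell_index_half (k : nat) (x : R) :
  cell_index k x = (cell_index k.+1 x %/ 2)%Z.
Proof.
rewrite /cell_index exprS -mulrA.
have /andP[a b] := floor_itv (2 ^+ k * x)%R.
have /andP[c d] := floor_itv (2 * (2 ^+ k * x))%R.
set m := Num.floor (2 ^+ k * x)%R in a b *; set n := Num.floor (2 * _)%R in c d *.
have h1 : (2 * m < n + 1)%R.
  by rewrite -(ltr_int R) intrM; apply: le_lt_trans d; rewrite ler_pM2l.
have h2 : (n < 2 * (m + 1))%R.
  by rewrite -(ltr_int R) intrM; apply: (le_lt_trans c); rewrite ltr_pM2l.
lia.
Qed.

Lemma cell_index_coarse (l k : nat) (x y : R) : (l <= k)%N ->
  cell_index k x = cell_index k y -> cell_index l x = cell_index l y.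
Proof.
move=> /subnK <-; elim: (k - l)%N => [//|d IH]; rewrite addSn => e.
by apply: IH; rewrite !(cell_index_half (d + l)) e.
Qed.

End Cells.

Section Content.
Context {R : realType}.
Variable w : R.
Hypothesis w0 : 0 < w.
Local Notation cells := (set (nat * int)).

Definition cell (p : nat * int) : set R := [set x | cell_index p.1 x = p.2].

Definition cells_cover (S : cells) (A : set R) : Prop :=
  forall x, A x -> exists k, S (k, cell_index k x).

Definition cells_weight (S : cells) : \bar R := esum S (fun p => (w ^+ p.1)%:E).

(** For [w] = 2^(-beta) this is the dyadic Hausdorff content of dimension beta. *)
Definition content (A : set R) : \bar R :=
  ereal_inf [set cells_weight S | S in [set S | cells_cover S A]].

Local Open Scope ereal_scope.

Let wt0 (p : nat * int) : 0 <= (w ^+ p.1)%:E :> \bar R.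
Proof. by rewrite lee_fin exprn_ge0 // ltW. Qed.

Lemma cells_weight_ge0 (S : cells) : 0 <= cells_weight S.
Proof. exact: esum_ge0. Qed.

Lemma content_le (A : set R) (S : cells) : cells_cover S A -> content A <= cells_weight S.
Proof. by move=> SA; apply: ereal_inf_lbound; exists S. Qed.

Lemma content_lt (A : set R) (r : \bar R) : content A < r ->
  exists2 S, cells_cover S A & cells_weight S < r.
Proof. by move=> /ereal_inf_lt [_ [S SA <-] h]; exists S. Qed.

Lemma content_ge0 (A : set R) : 0 <= content A.
Proof. by apply: le_ereal_inf_tmp => _ [S _ <-]; exact: cells_weight_ge0. Qed.

Lemma content_mono (A B : set R) : A `<=` B -> content A <= content B.
Proof.
move=> AB; apply: le_ereal_inf_tmp => _ [S SB <-]; apply: content_le => x /AB; exact: SB.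
Qed.

Lemma content_cell (A : set R) (p : nat * int) : A `<=` cell p -> content A <= (w ^+ p.1)%:E.
Proof.
move=> Ap; rewrite -(@esum_set1 _ _ p (fun p => (w ^+ p.1)%:E)) //.
by apply: content_le => x /Ap xp; exists p.1; rewrite xp; case: p {Ap xp}.
Qed.

(** Countable subadditivity. The pieces are indexed by cells because they will be traces of [A] on
    cells; the strict bounds supply the covers that are glued. *)
Lemma content_union (A : set R) (S : cells) (B : nat * int -> set R) (r : nat * int -> R) :
  (forall x, A x -> exists2 p, S p & B p x) -> (forall p, S p -> content (B p) < (r p)%:E) ->
  content A <= esum S (fun p => (r p)%:E).
Proof.
move=> AS Br.
have /boolp.choice [F hF] : forall p, exists G, S p -> cells_cover G (B p) /\ cells_weight G <
    (r p)%:E.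
  move=> p; have [Sp|nS] := pselect (S p); last by exists set0.
  by have [G GB Gr] := content_lt (Br p Sp); exists G.
apply: (@le_trans _ _ (cells_weight (\bigcup_(p in S) F p))).
  apply: content_le => x /AS [p Sp Bx]; have [FB _] := hF p Sp.
  by have [k Fk] := FB x Bx; exists k, p.
apply: (le_trans (esum_bigcup_le _ _ _)) => //.
by apply: le_esum => p /hF [_ /ltW].
Qed.

Lemma content_split (A : set R) (k : nat) (i : int) : A `<=` cell (k, i) ->
  content A <= content (A `&` cell (k.+1, (2 * i)%R)) + content (A `&` cell (k.+1, (2 * i + 1)%R)).
Proof.
move=> Aki.
have fin (B : set R) p : B `<=` cell p -> content B \is a fin_num.
  move=> Bp; rewrite ge0_fin_numE ?content_ge0 //.
  by apply: le_lt_trans (content_cell Bp) _; rewrite ltry.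
pose B (p : nat * int) := A `&` cell p.
have Bfin p : content (B p) \is a fin_num by apply: (@fin _ p) => x [].
apply/lee_addgt0Pr => e e0.
pose r (p : nat * int) := (fine (content (B p)) + e / 2)%R.
pose p1 : nat * int := (k.+1, (2 * i)%R); pose p2 : nat * int := (k.+1, (2 * i + 1)%R).
apply: (@le_trans _ _ (esum [set p1; p2] (fun p => (r p)%:E))).
  apply: (@content_union _ _ B).
    move=> x Ax; have := Aki x Ax; rewrite /cell /= cell_index_half => e'.
    have [h|h] : cell_index k.+1 x = (2 * i)%R \/ cell_index k.+1 x = (2 * i + 1)%R by lia.
      by exists p1; [left | split].
    by exists p2; [right | split].
  by move=> p _; rewrite /r EFinD fineK // lteDl // lte_fin divr_gt0.
have r0 p : 0 <= (r p)%:E.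
  by rewrite lee_fin /r addr_ge0 ?fine_ge0 ?content_ge0 // ltW // divr_gt0.
have p12 : p1 <> p2 by move=> /(congr1 snd) /=; lia.
rewrite esum_fset; [|by rewrite finite_setU; split|by []].
rewrite fsbigU0; [|by []|by []|by move=> x [-> /p12]].
have rE p : (r p)%:E = content (B p) + (e / 2)%:E by rewrite /r EFinD fineK.
by rewrite !fsbig_set1 !rE [leLHS]addeACA -EFinD -splitr.
Qed.

(* Otherwise every set would be covered, up to a factor less than 1, more
   cheaply than by any given cover. *)
Lemma content_density (A : set R) (c : R) : (0 < c < 1)%R -> content A != 0 ->
  exists p, (c * w ^+ p.1)%:E < content (A `&` cell p).
Proof.
move=> /andP[c0 c1] A0; apply: contrapT => nE.
have ub p : content (A `&` cell p) <= (c * w ^+ p.1)%:E.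
  by rewrite leNgt; apply/negP => h; apply: nE; exists p.
(* [content_union] takes strict bounds, hence a second constant between [c] and 1. *)
pose c' := ((c + 1) / 2)%R; have cc' : (c < c')%R by rewrite /c'; lra.
have c'1 : (c' < 1)%R by rewrite /c'; lra.
have c'0 : (0 < c')%R by exact: lt_trans cc'.
(* Within one cell the content is finite, so a positive [m] is less than [m / c']. A cover of weight
   below [m / c'], with each piece improved by the factor [c'], would bound [m] by less than
   itself. *)
have zero p : content (A `&` cell p) = 0.
  apply/eqP; rewrite eq_le content_ge0 andbT leNgt; apply/negP => pos.
  have fin : content (A `&` cell p) \is a fin_num.
    rewrite ge0_fin_numE ?content_ge0 //.
    by apply: le_lt_trans (content_cell (@subIsetr _ _ _)) _; rewrite ltry.
  set m := content _ in pos fin *.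
  have : m < (c'^-1)%:E * m.
    rewrite -(fineK fin) -EFinM lte_fin ltr_pMl ?invf_gt1 //.
    by rewrite -lte_fin fineK.
  move=> /content_lt [S SA hS].
  have : m <= esum S (fun p => (c' * w ^+ p.1)%:E).
    apply: (@content_union _ _ (fun q => A `&` cell q)).
      move=> x [Ax px]; have [k Sk] := SA x (conj Ax px).
      by exists (k, cell_index k x).
    move=> q _; apply: (le_lt_trans (ub q)).
    by rewrite lte_fin ltr_pM2r // exprn_gt0.
  under eq_esum do rewrite EFinM.
  move=> /le_trans /(_ (esum_scale_le _ (ltW c'0) wt0)); rewrite leNgt => /negP; apply.
  by rewrite -lte_pdivlMl.
(* [A] is the countable union of its null traces on the cells of level 0. *)
move/eqP: A0; apply; apply/eqP; rewrite eq_le content_ge0 andbT.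
apply/lee_addgt0Pr => e e0; rewrite add0e.
pose S : cells := [set p | p.1 = 0%N].
pose r (p : nat * int) : R := (e / (2 ^ (pickle p).+1)%:R)%R.
apply: (@le_trans _ _ (esum S (fun p => (r p)%:E))).
  apply: (@content_union _ _ (fun q => A `&` cell q)).
    by move=> x Ax; exists (0%N, cell_index 0 x).
  by move=> q _; rewrite zero lte_fin divr_gt0 // ltr0n expn_gt0.
rewrite -(@esum_image _ _ _ S pickle (fun n => (e / (2 ^ n.+1)%:R)%:E)); last first.
  by move=> x y _ _; exact: (pcan_inj pickleK).
apply: le_trans (epsilon_trick0 xpredT (ltW e0)).
rewrite nneseries_esumT; first exact: esum_subset.
by move=> n; rewrite lee_fin divr_ge0 // ltW.
Qed.

End Content.

(** * Comparison with the Hausdorff dimension *)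

Section Hausdorff.
Context {R : realType}.
Local Open Scope ereal_scope.

Lemma diam_ge0 (A : set R) : A !=set0 -> 0 <= diam A.
Proof.
move=> [x Ax]; apply: ereal_sup_ubound; exists (x, x) => //=.
by rewrite subrr normr0.
Qed.

Lemma diam_cell (p : nat * int) : diam (cell p : set R) <= ((1 / 2) ^+ p.1)%:E.
Proof.
apply: ge_ereal_sup => _ [[x y] [/= px py] <-]; rewrite lee_fin.
move: px py; rewrite /cell /= /cell_index => px py.
have /andP[a b] := floor_itv (2 ^+ p.1 * x)%R; have /andP[c d] := floor_itv (2 ^+ p.1 * y)%R.
rewrite px in a b; rewrite py in c d.
have h : (`|2 ^+ p.1 * x - 2 ^+ p.1 * y| <= 1)%R.
  by move: b d; rewrite intrD => b d; rewrite ler_distl; apply/andP; split; lra.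
move: h; rewrite -mulrBr normrM ger0_norm ?exprn_ge0 // -ler_pdivlMl ?exprn_gt0 //.
by rewrite mulr1 mul1r exprVn.
Qed.

Lemma hausdorff_weight_ge0 (s : R) (U : set R) : 0 <= hausdorff_weight s U.
Proof. by rewrite /hausdorff_weight; case: ifP => // _; exact: poweR_ge0. Qed.

Lemma weight_powR (beta : R) (k : nat) : ((2 `^ (- beta)) ^+ k = ((1 / 2) ^+ k) `^ beta :> R)%R.
Proof.
have -> : ((1 / 2) ^+ k = 2 `^ (- k%:R) :> R)%R.
  by rewrite powRN powR_mulrn // mul1r exprVn.
rewrite -powR_mulrn; last exact: powR_ge0.
by rewrite -!powRrM !mulNr [in RHS]mulrC.
Qed.

Lemma hausdorff_weight_cell (beta : R) (p : nat * int) : (0 <= beta)%R ->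
  hausdorff_weight beta (cell p : set R) <= (((2 `^ (- beta)) ^+ p.1)%R)%:E.
Proof.
move=> b0; have w0 : (0 <= 2 `^ (- beta))%R by exact: powR_ge0.
rewrite /hausdorff_weight; case: eqVneq => [_|/set0P ne]; first by rewrite lee_fin exprn_ge0.
have -> : ((2 `^ (- beta)) ^+ p.1)%R%:E = (((1 / 2) ^+ p.1)%R%:E) `^ beta :> \bar R.
  by rewrite poweR_EFin weight_powR.
by apply: gt0_ler_poweR; rewrite ?in_itv /= ?andbT ?leey ?diam_ge0 ?diam_cell ?lee_fin ?exprn_ge0.
Qed.

(** Content zero implies measure zero: a cover of total weight below d^beta contains only cells of
    diameter at most [d], so the size restriction of the premeasure is automatic. *)
Lemma content_neq0 (beta : R) (E : set R) : (0 < beta)%R ->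
  beta%:E < hausdorff_dim E -> content (2 `^ (- beta)) E != 0.
Proof.
move=> b0; apply: contraTneq => E0; rewrite -leNgt; apply: ereal_inf_lbound.
exists beta => //; split; first exact: ltW.
have pre0 (d : R) : (0 < d)%R -> hausdorff_premeasure d beta E = 0.
  move=> d0; apply/eqP; rewrite eq_le; apply/andP; split; last first.
    apply: le_ereal_inf_tmp => _ [U _ <-]; apply: nneseries_ge0 => n _ _.
    exact: hausdorff_weight_ge0.
  apply/lee_addgt0Pr => e e0; rewrite add0e.
  set w := (2 `^ (- beta))%R in E0.
  have w0 : (0 < w)%R by exact: powR_gt0.
  have [S SE hS] : exists2 S, cells_cover S E & cells_weight w S < (Num.min e (d `^ beta)%R)%:E.
    by apply: content_lt; rewrite E0 lte_fin lt_min e0 powR_gt0.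
  (* Numbers that code no cell of [S] give the empty set, of weight 0 and diameter -oo. *)
  pose U n := if @pickle_inv (nat * int)%type n is Some p then (if p \in S then cell p else
      set0) else set0 : set R.
  have US p : S p -> U (pickle p) = cell p by move=> Sp; rewrite /U pickleK_inv mem_set.
  have Uns n : ~ (pickle @` S) n -> U n = set0.
    move=> nS; rewrite /U; have := @pickle_invK (nat * int)%type n.
    case: pickle_inv => [p|] //= pn; case: ifPn => // /set_mem Sp.
    by case: nS; exists p.
  have Sd p : S p -> ((1 / 2) ^+ p.1 <= d)%R.
    move=> Sp; have : (w ^+ p.1)%:E < (d `^ beta)%:E.
      apply: (@le_lt_trans _ _ (cells_weight w S)); last first.
        by apply: (lt_le_trans hS); rewrite lee_fin ge_min lexx orbT.
      rewrite -(@esum_set1 _ _ p (fun p => (w ^+ p.1)%:E));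
          last by rewrite lee_fin exprn_ge0 // ltW.
      by apply: esum_subset => _ ->.
    rewrite lte_fin /w weight_powR => h; rewrite leNgt; apply/negP => dp.
    move: h; rewrite ltNge => /negP; apply; apply: ge0_ler_powR;
        rewrite ?nnegrE ?exprn_ge0 // ltW //.
  apply: (@le_trans _ _ (\sum_(i <oo) hausdorff_weight beta (U i))).
    apply: ereal_inf_lbound; exists U => //; split.
      move=> x Ex; have [k Sk] := SE x Ex; exists (pickle (k, cell_index k x)) => //.
      by rewrite US.
    move=> i; have [[p Sp <-]|nS] := pselect ((pickle @` S) i).
      by rewrite US //; apply: (le_trans (diam_cell p)); rewrite lee_fin Sd.
    rewrite Uns //; apply: ge_ereal_sup => _ [[x y] [] []].
  apply: (@le_trans _ _ (cells_weight w S)); last first.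
    by apply: ltW; apply: (lt_le_trans hS); rewrite lee_fin ge_min lexx.
  rewrite nneseries_esumT; last by move=> n; exact: hausdorff_weight_ge0.
  rewrite (esumID (pickle @` S)); last by move=> n _; exact: hausdorff_weight_ge0.
  rewrite setTI [X in _ + X]esum1 ?adde0; last first.
    by move=> n [_ /Uns ->]; rewrite /hausdorff_weight eqxx.
  rewrite esum_image; last by move=> x y _ _; exact: (pcan_inj pickleK).
  apply: le_esum => p Sp; rewrite US //; exact: hausdorff_weight_cell (ltW b0).
apply/eqP; rewrite eq_le; apply/andP; split.
  by apply: ge_ereal_sup => _ [d /= d0 <-]; rewrite pre0.
by apply: ereal_sup_ubound; exists 1%R => //=; exact: pre0.
Qed.

End Hausdorff.

(** * Borel sets are Suslin sets *)

Lemma seq_dependent_choice (P : seq nat -> Prop) : P [::] ->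
  (forall s, P s -> exists m, P (rcons s m)) -> exists sigma, forall n, P (mkseq sigma n).
Proof.
move=> P0 PS.
have [f [f0 fS]] : {f : nat -> {s | P s} | f 0%N = exist _ [::] P0 /\
    forall n, exists m, sval (f n.+1) = rcons (sval (f n)) m}.
  apply: (@dependent_choice _ (fun a b : {s | P s} => exists m, sval b = rcons (sval a) m)).
  by move=> [s Ps]; have /cid [m Pm] := PS s Ps; exists (exist _ _ Pm); exists m.
have [g hg] := boolp.choice fS.
exists g => n; suff <- : sval (f n) = mkseq g n by exact: svalP.
elim: n => [|n IH]; first by rewrite f0.
by rewrite hg IH /mkseq -addn1 iotaD map_cat cats1.
Qed.

Section Suslin.
Context {T : topologicalType}.

(** The Suslin operation, for schemes that may fail to decrease along prefixes. *)
Definition suslin_op (F : seq nat -> set T) : set T :=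
  [set x | exists sigma : nat -> nat, forall n, F (mkseq sigma n) x].

Definition suslin (A : set T) : Prop :=
  exists2 F : seq nat -> set T, (forall s, closed (F s)) & A = suslin_op F.

Lemma suslin_closed (A : set T) : closed A -> suslin A.
Proof.
move=> cA; exists (fun=> A) => //; apply/seteqP; split => x /=; first by exists id.
by move=> [s /(_ 0%N)].
Qed.

(** The first letter of a branch names the set, and the rest is a branch of its scheme. *)
Lemma suslin_bigcup (A : nat -> set T) : (forall n, suslin (A n)) -> suslin (\bigcup_n A n).
Proof.
move=> sA; have /boolp.choice [F hF] : forall n, exists F : seq nat -> set T,
   (forall s, closed (F s)) /\ A n = suslin_op F by move=> n; have [F] := sA n; exists F.
pose G s := if s is i :: s' then F i s' else setT.
exists G.
  by move=> [|i s]; [exact: closedT | exact: (proj1 (hF i) s)].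
have mkS (h : nat -> nat) n : mkseq h n.+1 = h 0%N :: mkseq (fun i => h i.+1) n.
  by rewrite /mkseq /= -[1%N]addn0 iotaDl -map_comp.
apply/seteqP; split => x.
  move=> [i _]; have [_ ->] := hF i => -[h hx].
  exists (fun n => if n is m.+1 then h m else i); case=> [//|n].
  by rewrite mkS; exact: hx.
move=> [h hx]; exists (h 0%N) => //; have [_ ->] := hF (h 0%N).
by exists (fun i => h i.+1) => n; have := hx n.+1; rewrite mkS.
Qed.

(* A branch of the intersection scheme codes one branch of each [F i], the
   letter [j] of the [i]-th branch being stored at position [pickle (i, j)]. *)
Lemma suslin_bigcap (A : nat -> set T) : (forall n, suslin (A n)) -> suslin (\bigcap_n A n).
Proof.
move=> sA; have /boolp.choice [F hF] : forall n, exists F : seq nat -> set T,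
   (forall s, closed (F s)) /\ A n = suslin_op F by move=> n; have [F] := sA n; exists F.
pose G s := [set x | forall i n, (forall j, (j < n)%N -> (pickle (i, j) < size s)%N) ->
  F i (mkseq (fun j => nth 0%N s (pickle (i, j))) n) x].
exists G.
  move=> s; rewrite [G s](_ : _ = \bigcap_(p in [set p : nat * nat | forall j,
      (j < p.2)%N -> (pickle (p.1, j) < size s)%N])
     F p.1 (mkseq (fun j => nth 0%N s (pickle (p.1, j))) p.2)); last first.
    apply/seteqP; split => x; first by move=> h [i n] /= /h.
    by move=> h i n hn; exact: (h (i, n)).
  by apply: closed_bigI => p _; exact: (proj1 (hF p.1)).
apply/seteqP; split => x.
  move=> Ax; have /boolp.choice [h hh] : forall i, exists h : nat -> nat, forall n,
      F i (mkseq h n) x.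
    by move=> i; have := Ax i I; have [_ ->] := hF i.
  exists (fun m => if @unpickle (nat * nat)%type m is Some p then h p.1 p.2 else 0%N) => N i n hn.
  have := hh i n; congr (F i _ x); apply/eq_in_map => j; rewrite mem_iota add0n => /andP[_ jn].
  by rewrite nth_mkseq ?pickleK //; have := hn j jn; rewrite size_mkseq.
move=> [h hx] i _; have [_ ->] := hF i.
exists (fun j => h (pickle (i, j))) => n.
pose N := \max_(j < n) (pickle (i, nat_of_ord j)).+1.
have lN j : (j < n)%N -> (pickle (i, j) < N)%N.
  by move=> jn; exact: (@leq_bigmax _ (fun j : 'I_n => (pickle (i, nat_of_ord j)).+1) (Ordinal jn)).
have := hx N i n; rewrite size_mkseq => /(_ lN); congr (F i _ x).
apply/eq_in_map => j; rewrite mem_iota add0n => /andP[_ jn].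
by rewrite nth_mkseq // lN.
Qed.

Lemma suslin_setU (A B : set T) : suslin A -> suslin B -> suslin (A `|` B).
Proof.
move=> sA sB; have -> : A `|` B = \bigcup_n (if n is 0%N then A else B).
  apply/seteqP; split => x; first by case=> h; [exists 0%N | exists 1%N].
  by move=> [[|n] _ h]; [left | right].
by apply: suslin_bigcup => -[|n].
Qed.

End Suslin.

Section Borel.
Context {R : realType}.

Lemma suslin_gt (a : R) : suslin [set x | a < x].
Proof.
have -> : [set x | a < x] = \bigcup_n [set x | a + n.+1%:R^-1 <= x].
  apply/seteqP; split => x /=.
    by move=> /ltr_add_invr [n hn]; exists n => //=; exact: ltW.
  by move=> [n _ /=]; apply: lt_le_trans; rewrite ltrDl invr_gt0 ltr0n.
by apply: suslin_bigcup => n; apply: suslin_closed; exact: closed_ge.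
Qed.

(** Suslin sets are not closed under complement, but the sets that are Suslin together with their
    complement form a sigma-algebra, which contains the half-open intervals. *)
Lemma suslin_measurable (E : set R) : measurable (E : set (measurableTypeR R)) -> suslin E.
Proof.
move=> mE; suff : suslin E /\ suslin (~` E) by case.
have /(_ E mE) : @measurable _ (measurableTypeR R) `<=` [set A : set R | suslin A /\ suslin (~` A)].
  apply: smallest_sub.
    split.
    - split; first by apply: suslin_closed; exact: closed0.
      by rewrite setC0; apply: suslin_closed; exact: closedT.
    - by move=> A [sA sAc]; rewrite setTD; split => //; rewrite setCK.
    - move=> A sA; split; first by apply: suslin_bigcup => n; have [] := sA n.
      by rewrite setC_bigcup; apply: suslin_bigcap => n; have [] := sA n.
  move=> _ [[a b] _ <-] /=; split.
    have -> : [set` `]a, b]] = \bigcap_n (if n is 0%N then [set x | a < x] else [set x | x <= b]).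
      apply/seteqP; split => x /=; rewrite in_itv /=.
        by move=> /andP[ax xb] [|n].
      by move=> h; apply/andP; split; [exact: (h 0%N I) | exact: (h 1%N I)].
    apply: suslin_bigcap => -[|n]; first exact: suslin_gt.
    by apply: suslin_closed; exact: closed_le.
  have -> : ~` [set` `]a, b]] = [set x | x <= a] `|` [set x | b < x].
    apply/seteqP; split => x /=; rewrite in_itv /=.
      by move=> /negP; rewrite negb_and -!leNgt -ltNge => /orP.
    by move=> h; apply/negP; rewrite negb_and -!leNgt -ltNge; apply/orP.
  apply: suslin_setU; last exact: suslin_gt.
  by apply: suslin_closed; exact: closed_le.
by [].
Qed.

End Borel.

(** * Capacitability of the dyadic content *)

Section Increasing.
Context {R : realType}.
Variable w : R.
Hypothesis w0 : 0 < w.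
Local Notation cells := (set (nat * int)).
Local Open Scope ereal_scope.

Let wt0 (p : nat * int) : 0 <= (w ^+ p.1)%:E :> \bar R.
Proof. by rewrite lee_fin exprn_ge0 // ltW. Qed.

(** The cells of [S] contained in no larger cell of [S]. As cells are nested or disjoint, larger
    cells can be detected through the points of [p]. *)
Definition maximal_cells (S : cells) : cells :=
  [set p | S p /\ forall (x : R) k, cell p x -> S (k, cell_index k x) -> (p.1 <= k)%N].

Lemma maximal_cells_cover (S : cells) (A : set R) :
  cells_cover S A -> cells_cover (maximal_cells S) A.
Proof.
move=> SA x Ax; have [k0 Sk0] := SA x Ax.
have [k /asboolP Sk kmin] := ex_minnP (ex_intro (fun k => `[<S (k,
    cell_index k x)>]) k0 (introT (asboolP _) Sk0)).
exists k; split => // y l; rewrite /cell /= => yx Sl; rewrite leqNgt; apply/negP => lk.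
have := kmin l; rewrite -(cell_index_coarse (ltnW lk) yx) leqNgt lk; move=> h.
by have := h (introT (asboolP _) Sl).
Qed.

Lemma cells_weightU_le (S T : cells) : cells_weight w (S `|` T) <=
    cells_weight w S + cells_weight w T.
Proof.
rewrite /cells_weight (esumID S) //; apply: leeD; apply: esum_subset => p [] //.
by case.
Qed.

Lemma cells_weightUI (S T : cells) :
  cells_weight w (S `|` T) + cells_weight w (S `&` T) = cells_weight w S + cells_weight w T.
Proof.
rewrite /cells_weight (esumID S (S `|` T)) // (esumID S T) //.
have -> : (S `|` T) `&` S = S.
  by apply/seteqP; split => [p []//|p Sp]; split => //; left.
have -> : (S `|` T) `&` ~` S = T `&` ~` S.
  by apply/seteqP; split => [p [[]]//|p [Tp nS]]; split => //; right.
by rewrite [S `&` T]setIC -addeA [X in _ + X]addeC.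
Qed.

(* Strong subadditivity: where both families cover a point, two of their cells
   contain it, and only one of them is needed in the maximal subfamily. *)
Lemma maximal_cells_weight (S T : cells) (A : set R) :
  cells_cover S A -> cells_cover T A ->
  cells_weight w (maximal_cells (S `|` T)) + content w A <= cells_weight w S + cells_weight w T.
Proof.
move=> SA TA; set V := maximal_cells _; set U := S `|` T in V *.
have -> : cells_weight w S + cells_weight w T =
   cells_weight w V + (cells_weight w (U `&` ~` V) + cells_weight w (S `&` T)).
  rewrite -cells_weightUI -/U addeA; congr (_ + _).
  rewrite /cells_weight (esumID V U) //; congr (_ + _); congr esum.
  by apply/seteqP; split => [p []//|p Vp]; split => //; case: Vp.
apply: leeD => //; apply: le_trans (cells_weightU_le _ _).
apply: content_le => x Ax; have [k Sk] := SA x Ax; have [l Tl] := TA x Ax.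
have nV (i j : nat) : (i < j)%N -> U (i, cell_index i x) -> ~ V (j, cell_index j x).
  by move=> ij Ui [_ /(_ x i erefl Ui)] /=; rewrite leqNgt ij.
have [kl|lk|e] := ltngtP k l.
- exists l; left; split; first by right.
  by apply: (nV k) => //; left.
- exists k; left; split; first by left.
  by apply: (nV l) => //; right.
- by exists k; right; split => //; rewrite e.
Qed.

(** Nearly optimal covers [S n] are merged in turn, keeping the maximal cells. By strong
    subadditivity the excess over the content of [A n] grows at each merge only by the error of the
    new cover, so it stays below [e]. *)
Lemma content_increasing (A : nat -> set R) (c : R) :
  (forall n, A n `<=` A n.+1) -> (forall n, content w (A n) <= c%:E) ->
  content w (\bigcup_n A n) <= c%:E.
Proof.
move=> Ainc Ac; apply/lee_addgt0Pr => e e0.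
have Afin n : content w (A n) \is a fin_num.
  by rewrite ge0_fin_numE ?content_ge0 //; apply: le_lt_trans (Ac n) _; rewrite ltry.
have /boolp.choice [S hS] : forall n, exists S, cells_cover S (A n) /\
    cells_weight w S < content w (A n) + (e * (1 / 2) ^+ n.+1)%:E.
  move=> n; have [|S SA Sw] := @content_lt _ w (A n) (content w (A n) + (e * (1 / 2) ^+ n.+1)%:E).
    by rewrite lteDl // lte_fin mulr_gt0 // exprn_gt0 // divr_gt0.
  by exists S.
pose V := fix V n := if n is m.+1 then maximal_cells (V m `|` S n) else S 0%N.
have VA n : cells_cover (V n) (A n).
  case: n => [|n]; first by have [] := hS 0%N.
  apply: maximal_cells_cover => x Ax; have [SA _] := hS n.+1.
  by have [k Sk] := SA x Ax; exists k; right.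
have Vw n : cells_weight w (V n) <= content w (A n) + (e * (1 - (1 / 2) ^+ n.+1))%:E.
  elim: n => [|n IH].
    have [_ /ltW h] := hS 0%N; apply: (le_trans h); apply: leeD => //.
    by rewrite lee_fin ler_pM2l // !expr1; lra.
  have [SA Sw] := hS n.+1.
  have SAn : cells_cover (S n.+1) (A n) by move=> x /Ainc; exact: SA.
  have := maximal_cells_weight (VA n) SAn => /le_trans /(_ (leeD IH (ltW Sw))).
  rewrite -[X in X <= _]/(cells_weight w (V n.+1) + content w (A n)).
  rewrite [X in X <= _]addeC -addeA leeD2lE // addeCA => /le_trans; apply.
  rewrite -EFinD leeD2lE // lee_fin [((1 / 2) ^+ n.+2)%R]exprS; lra.
have Vc n : cells_weight w (V n) <= (c + e)%:E.
  apply: (le_trans (Vw n)); rewrite EFinD; apply: leeD => //.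
  by rewrite lee_fin ger_pMr // gerBl exprn_ge0 // divr_ge0.
(* The cells that survive all later merges. The cell of [V n] around a point can only be replaced by
   a larger one, so it is eventually constant. *)
pose Vinf : cells := [set p | exists N, forall n, (N <= n)%N -> V n p].
apply: (@le_trans _ _ (cells_weight w Vinf)).
  apply: content_le => x [m _ Ax].
  have Amn n : (m <= n)%N -> A n x.
    by move=> /subnK <-; elim: (n - m)%N => [//|d IH]; rewrite addSn; exact: Ainc.
  pose P k := exists2 n, (m <= n)%N & V n (k, cell_index k x).
  have [k0 Vk0] := VA m x Ax; have P0 : P k0 by exists m.
  have [k /asboolP [N mN VN] kmin] := ex_minnP (ex_intro (fun k => `[<P k>]) k0 (introT (asboolP
      _) P0)).
  exists k; exists N => n /subnK <-; elim: (n - N)%N => [//|d IH]; rewrite addSn.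
  have [l Vl] := VA (d + N).+1 x (Amn _ (leq_trans mN (leqW (leq_addl _ _)))).
  have lk : (l <= k)%N by have [_ /(_ x k erefl)] := Vl; apply; left.
  have kl : (k <= l)%N.
    by apply: kmin; apply/asboolP; exists (d + N).+1 => //;
        exact: (leq_trans mN (leqW (leq_addl _ _))).
  by have <- : l = k by apply/eqP; rewrite eqn_leq lk kl.
apply: ge_ereal_sup => _ [X [fX XV] <-].
(* A finite part of [Vinf] lies in a single [V N], whose weight is bounded. *)
have [N XN] : exists N, X `<=` V N.
  suff [N hN] : exists N, forall n, (N <= n)%N -> X `<=` V n by exists N; exact: hN.
  have /finite_seqP [s EX] := fX; rewrite EX in XV *.
  elim: s XV {EX} => [|p s IH] sV; first by exists 0%N => n _ q.
  have [N1 h1] : exists N, forall n, (N <= n)%N -> [set` s] `<=` V n.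
    by apply: IH => q qs; apply: sV => /=; rewrite inE; apply/orP; right.
  have [N2 h2] : Vinf p by apply: sV => /=; rewrite inE eqxx.
  exists (maxn N1 N2) => n; rewrite geq_max => /andP[n1 n2] q /=; rewrite inE => /orP[/eqP ->|qs].
    exact: h2.
  exact: h1.
apply: le_trans (Vc N); rewrite -esum_fset //; exact: esum_subset.
Qed.

(* Koenig: only finitely many letters are allowed at each position. *)
Lemma capacitable (E D : set R) (c : R) : suslin E -> c%:E < content w (E `&` D) ->
  exists K : nat -> set R, [/\ forall n, closed (K n), forall n, K n.+1 `<=` K n,
    \bigcap_n K n `<=` E & forall n, c%:E < content w (K n `&` D)].
Proof.
move=> [F Fcl ->] cE.
pose Ab (b : seq nat) := [set x | exists sigma : nat -> nat,
  (forall i, (i < size b)%N -> (sigma i <= nth 0%N b i)%N) /\ forall n, F (mkseq sigma n) x].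
(* The sets obtained by bounding the next letter by [m] increase with [m] to the whole, so by
   [content_increasing] some bound keeps the content above [c]. *)
have [b hb] : exists b, forall n, c%:E < content w (Ab (mkseq b n) `&` D).
  apply: (@seq_dependent_choice (fun s => c%:E < content w (Ab s `&` D))).
    apply: lt_le_trans cE _; apply: content_mono; apply: setSI => x [h hx].
    by exists h; split.
  move=> s; apply: contraPP => nE; apply/negP; rewrite -leNgt.
  have -> : Ab s `&` D = \bigcup_m (Ab (rcons s m) `&` D).
    rewrite -setI_bigcupl; congr (_ `&` _); apply/seteqP; split => x.
      move=> [h [hs hx]]; exists (h (size s)) => //; exists h; split => // i.
      rewrite size_rcons ltnS leq_eqVlt nth_rcons => /orP[/eqP ->|i_s].
        by rewrite ltnn eqxx.
      by rewrite i_s; exact: hs.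
    move=> [m _ [h [hs hx]]]; exists h; split => // i i_s.
    have := hs i; rewrite size_rcons nth_rcons i_s; apply; exact: ltnW.
  apply: content_increasing => [m|m].
    apply: setSI => x [h [hs hx]]; exists h; split => // i; rewrite size_rcons => i_s.
    have := hs i; rewrite size_rcons !nth_rcons => /(_ i_s); case: ifP => // _.
    by case: ifP => // _; exact: leqW.
  by rewrite leNgt; apply/negP => h; apply: nE; exists m.
pose bs n := [set s : seq nat | size s = n /\ forall i, (i < n)%N -> (nth 0%N s i <= b i)%N].
pose T (x : R) s := forall j, (j <= size s)%N -> F (take j s) x.
(* [bs n] is finite, which makes this union of closed sets closed. All prefixes are tested because
   [F] may fail to decrease along them. *)
pose K n := \bigcup_(s in bs n) \bigcap_(j in [set j | (j <= n)%N]) F (take j s).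
have KE n x : K n x <-> exists2 s, bs n s & T x s.
  split; first by move=> [s [sn hs] h]; exists s; [split | move=> j; rewrite sn; exact: h].
  by move=> [s [sn hs] h]; exists s; [split | move=> j /=; rewrite -{1}sn; exact: h].
have bs_take n m s : (n <= m)%N -> bs m s -> bs n (take n s).
  move=> nm [sm hs]; split; first by rewrite size_take sm; case: ltngtP nm => // ->.
  by move=> i i_n; rewrite nth_take //; apply: hs; exact: leq_trans nm.
have T_take x n s : T x s -> T x (take n s).
  move=> Ts j; rewrite size_take_min leq_min => /andP[jn js].
  by rewrite take_takel //; exact: Ts.
exists K; split.
- move=> n; apply: closed_bigcup => [|s _]; last by apply: closed_bigI => j _; exact: Fcl.
  pose N := (\max_(i < n) b i).+1.
  apply: (@sub_finite_set _ _ ((fun t : n.-tuple 'I_N => [seq val i | i <- t]) @` setT)).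
    move=> s [sn hs].
    have sz : size [seq (inord i : 'I_N) | i <- s] == n by rewrite size_map sn.
    exists (Tuple sz) => //=; rewrite -map_comp -[RHS]map_id; apply/eq_in_map => i /= i_s.
    rewrite inordK //; have /(nthP 0%N) [j] := i_s; rewrite sn => jn <-.
    by rewrite ltnS; apply: (leq_trans (hs j jn)); exact: (@leq_bigmax _ (fun i : 'I_n => b i)
        (Ordinal jn)).
  by apply: finite_image; exact: finite_finset.
- move=> n x /KE [s bss Ts]; apply/KE; exists (take n s); last exact: T_take.
  exact: bs_take bss.
- move=> x Kx.
  (* A good word extends to an allowed word of every greater length. If each of the finitely many
     next letters failed at some length, no extension would be left at the largest of these
     lengths. *)
  pose good s := forall n, (size s <= n)%N -> exists2 s', bs n s' & take (size s) s' = s /\ T x s'.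
  have [sigma hs] : exists sigma, forall n, good (mkseq sigma n).
    apply: seq_dependent_choice.
      by move=> n _; have /KE [s h1 h2] := Kx n I; exists s => //; split => //; rewrite take0.
    move=> s gs; apply: contrapT => nE.
    have /boolp.choice [N hN] : forall i, exists n, (size s < n)%N /\
       forall s', bs n s' -> take (size s).+1 s' = rcons s i -> ~ T x s'.
      move=> i; apply: contrapT => nn; apply: nE; exists i => n; rewrite size_rcons => sn.
      apply: contrapT => ns; apply: nn; exists n; split => // s' bs' ts' Ts'.
      by apply: ns; exists s'.
    pose m := (\max_(i < (b (size s)).+1) N i).
    have hm i : (i <= b (size s))%N -> (N i <= m)%N.
      by move=> ib; exact: (@leq_bigmax _ (fun i : 'I_(b (size s)).+1 => N i) (Ordinal (ib : (i
          < (b (size s)).+1)%N))).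
    have sm : (size s < m)%N by apply: leq_trans (hm 0%N (leq0n _)); have [] := hN 0%N.
    have [s' bs' [ts' Ts']] := gs m (ltnW sm).
    have [ss' hs'] := bs'.
    pose i := nth 0%N s' (size s).
    have ib : (i <= b (size s))%N by exact: hs'.
    have [sN /(_ (take (N i) s'))] := hN i; apply.
    + exact: bs_take (hm i ib) bs'.
    + rewrite take_takel // (take_nth 0%N); last by rewrite ss'.
      by rewrite ts'.
    + exact: T_take.
  exists sigma => n; have [s' [ss' _] [ts' Ts']] := hs n n (eq_leq (size_mkseq sigma n)).
  have {}ts' : s' = mkseq sigma n.
    by rewrite -ts' size_mkseq -{1}ss' take_size.
  by have := Ts' n; rewrite ss' leqnn ts' -{1}(size_mkseq sigma n) take_size; apply.
- move=> n; apply: lt_le_trans (hb n) _; apply: content_mono; apply: setSI => x [h [hs hx]].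
  apply/KE; exists (mkseq h n).
    split; first by rewrite size_mkseq.
    by move=> i i_n; rewrite nth_mkseq //; have := hs i; rewrite size_mkseq nth_mkseq //; apply.
  move=> j; rewrite size_mkseq => jn.
  have -> : take j (mkseq h n) = mkseq h j; last exact: hx.
  by rewrite /mkseq -map_take take_iota (minn_idPl jn).
Qed.

End Increasing.

(** * Frostman atoms and the passage to the limit *)

Section Frostman.
Context {R : realType}.
Variable w : R.
Hypothesis w0 : 0 < w.

Lemma cell_mass_cat (s1 s2 : seq (R * R)) k i :
  cell_mass (s1 ++ s2) k i = cell_mass s1 k i + cell_mass s2 k i.
Proof. by rewrite /cell_mass big_cat. Qed.

Lemma cell_mass_le (s : seq (R * R)) k i : (forall a, a \in s -> 0 <= a.2) ->
  cell_mass s k i <= \sum_(a <- s) a.2.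
Proof.
move=> s0; rewrite /cell_mass big_mkcond [leLHS]big_seq [leRHS]big_seq.
by apply: ler_sum => a /s0 a0; case: ifP.
Qed.

Lemma cell_mass_eq0 (s : seq (R * R)) k i : (forall a, a \in s -> cell_index k a.1 != i) ->
  cell_mass s k i = 0.
Proof.
move=> h; rewrite /cell_mass big_seq_cond big1 // => a /andP[/h /negbTE ->].
by [].
Qed.

(** Mass is handed down the dyadic tree so that each cell receives at most the content of [K] in it,
    hence at most the weight of the cell; [content_split] makes this possible. After [r] generations
    every cell with positive mass puts it on one point of [K]. *)
Lemma frostman_atoms (K : set R) (r k : nat) (i : int) (m : R) : 0 <= m ->
  (m%:E <= content w (K `&` cell (k, i)))%E ->
  exists s : seq (R * R), [/\ forall a, a \in s -> [/\ K a.1, cell (k, i) a.1 & 0 <= a.2],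
    \sum_(a <- s) a.2 = m &
    forall k' i', (k <= k' <= k + r)%N -> cell_mass s k' i' <= w ^+ k'].
Proof.
have fin p : content w (K `&` cell p) \is a fin_num.
  rewrite ge0_fin_numE ?content_ge0 //.
  by apply: le_lt_trans (content_cell w0 (@subIsetr _ _ _)) _; rewrite ltry.
have cw k' i' : (content w (K `&` cell (k', i')) <= (w ^+ k')%:E)%E.
  exact: (content_cell w0 (@subIsetr _ K (cell (k', i')))).
have half_even (j : int) : ((2 * j) %/ 2)%Z = j by lia.
have half_odd (j : int) : ((2 * j + 1) %/ 2)%Z = j by lia.
have even_neq_odd (j : int) : 2 * j <> 2 * j + 1 by lia.
elim: r k i m => [|r IH] k i m m0 mK.
  have mw : m <= w ^+ k by rewrite -lee_fin (le_trans mK).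
  have [m_eq0|m_neq0] := eqVneq m 0.
    exists [::]; split => //; first by rewrite big_nil.
    by move=> *; rewrite /cell_mass big_nil exprn_ge0 // ltW.
  have [x [Kx cx]] : K `&` cell (k, i) !=set0.
    apply/set0P; apply/negP => /eqP E0; move: mK; rewrite E0 leNgt => /negP; apply.
    apply: (@le_lt_trans _ _ 0%E); last by rewrite lte_fin lt_def m_neq0.
    rewrite -(@esum_set0 R (nat * int)%type (fun p => (w ^+ p.1)%:E)).
    by apply: content_le.
  exists [:: (x, m)]; split.
  - by move=> a; rewrite inE => /eqP ->.
  - by rewrite big_seq1.
  - move=> k' i' hk; have -> : k' = k by lia.
    apply: le_trans mw; apply: (le_trans (cell_mass_le _ _ _)); last by rewrite big_seq1.
    by move=> a; rewrite inE => /eqP ->.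
pose p1 : nat * int := (k.+1, 2 * i); pose p2 : nat * int := (k.+1, 2 * i + 1).
have : (m%:E <= content w (K `&` cell p1) + content w (K `&` cell p2))%E.
  apply: (le_trans mK); apply: (le_trans (content_split w0 (@subIsetr _ _ _))).
  by apply: leeD; apply: content_mono; apply: setSI; exact: subIsetl.
set c1 := content w (K `&` cell p1); set c2 := content w (K `&` cell p2) => mc.
have f1 : c1 = (fine c1)%:E by rewrite fineK // fin.
have f2 : c2 = (fine c2)%:E by rewrite fineK // fin.
have g1 : 0 <= fine c1 by rewrite fine_ge0 // content_ge0.
have g2 : 0 <= fine c2 by rewrite fine_ge0 // content_ge0.
move: mc; rewrite f1 f2 -EFinD lee_fin => mc.
(* One half takes as much as its content permits; the rest fits into the other half. *)
pose m1 := Num.min m (fine c1).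
have m10 : 0 <= m1 by rewrite /m1 le_min m0.
have m1c : m1 <= fine c1 by rewrite /m1 ge_min lexx orbT.
have m1m : m1 <= m by rewrite /m1 ge_min lexx.
have m2c : m - m1 <= fine c2.
  rewrite /m1; have [h|h] := leP m (fine c1); first by rewrite subrr.
  by rewrite lerBlDl.
have [|s1 [h1 t1 b1]] := IH k.+1 (2 * i) m1 m10; first by rewrite -/p1 -/c1 f1 lee_fin.
have [||s2 [h2 t2 b2]] := IH k.+1 (2 * i + 1) (m - m1); first by rewrite subr_ge0.
  by rewrite -/p2 -/c2 f2 lee_fin.
have pos a : a \in s1 ++ s2 -> 0 <= a.2.
  by rewrite mem_cat => /orP[/h1[]|/h2[]].
have tot : \sum_(a <- s1 ++ s2) a.2 = m by rewrite big_cat /= t1 t2 addrC subrK.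
have sub a (x : R) : cell (k.+1, a) x -> cell_index k x = (a %/ 2)%Z.
  by rewrite /cell /= => <-; rewrite cell_index_half.
exists (s1 ++ s2); split => //.
- move=> a; rewrite mem_cat => /orP[/h1[Ka /sub ca a0]|/h2[Ka /sub ca a0]]; split => //.
    by rewrite /cell /= ca half_even.
  by rewrite /cell /= ca half_odd.
- move=> k' i' /andP[kk' k'r].
  have [<-|kk] := eqVneq k k'.
    apply: (le_trans (cell_mass_le _ _ pos)); rewrite tot.
    by rewrite -lee_fin (le_trans mK).
  have kk1 : (k < k')%N by rewrite ltn_neqAle kk.
  have kk2 : (k.+1 <= k' <= k.+1 + r)%N by rewrite kk1 addSnnS.
  rewrite cell_mass_cat.
  have [/hasP[a as1 /eqP ca]|/hasPn n1] := boolP (has (fun a => cell_index k' a.1 == i') s1);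
      last first.
    by rewrite (cell_mass_eq0 n1) add0r b2.
  rewrite (@cell_mass_eq0 s2) ?addr0 ?b1 // => a' as2; apply/eqP => ca'.
  have [_ e1 _] := h1 a as1; have [_ e2 _] := h2 a' as2.
  have := cell_index_coarse kk1 (etrans ca (esym ca')).
  by rewrite e1 e2; exact: even_neq_odd.
Qed.

(** Subcells of level k + k' become cells of level k', and dividing the masses by w^k keeps the form
    of the bounds. *)
Lemma frostman_atoms_rescaled (K : set R) (r k : nat) (i : int) (c : R) : 0 <= c ->
  ((c * w ^+ k)%:E <= content w (K `&` cell (k, i)))%E ->
  exists s : seq (R * R), [/\ forall a, a \in s -> [/\ K ((a.1 + i%:~R) / 2 ^+ k), 0 <=
      a.1 < 1 & 0 <= a.2],
    \sum_(a <- s) a.2 = c &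
    forall k' i', (k' <= r)%N -> cell_mass s k' i' <= w ^+ k'].
Proof.
move=> c0 cK; have wk : 0 < w ^+ k by rewrite exprn_gt0.
have p2 : 0 < 2 ^+ k :> R by rewrite exprn_gt0.
have [s [h t b]] := frostman_atoms r (mulr_ge0 c0 (ltW wk)) cK.
exists [seq (2 ^+ k * a.1 - i%:~R, a.2 / w ^+ k) | a <- s]; split.
- move=> _ /mapP[a /h[Ka ca a0] ->] /=; split.
  + by rewrite subrK mulrAC divff ?mul1r // gt_eqF.
  + move: ca; rewrite /cell /= /cell_index => ca.
    have /andP[x y] := floor_itv (2 ^+ k * a.1); rewrite ca in x y.
    by move: y; rewrite intrD => y; apply/andP; split; lra.
  + by rewrite divr_ge0 // ltW.
- by rewrite big_map /= -mulr_suml t mulfK // gt_eqF.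
- move=> k' i' k'r.
  have idx (x : R) : cell_index k' (2 ^+ k * x - i%:~R) = cell_index (k + k') x - 2 ^+ k' * i.
    rewrite /cell_index mulrBr mulrA -exprD addnC.
    have -> : 2 ^+ k' * i%:~R = (2 ^+ k' * i)%:~R :> R by rewrite intrM rmorphXn.
    by rewrite -intrN floorDrz ?intr_int // intrKfloor.
  rewrite /cell_mass big_map /=.
  under eq_bigl do rewrite idx subr_eq.
  rewrite -mulr_suml ler_pdivrMr // -exprD (addnC k').
  apply: b; lia.
Qed.

End Frostman.

(** * Compactness *)

Section Limit.
Context {R : realType}.

Lemma closed_approx (C : set R) (x : R) : closed C ->
  (forall e, 0 < e -> exists2 a, C a & `|x - a| < e) -> C x.
Proof.
move=> cC h; apply: cC => B /nbhs_ballP [e e0 eB].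
have [a Ca xa] := h e e0; exists a; split => //; exact: eB.
Qed.

Lemma limit_pattern (L : nat -> set R) (q t : R) (m0 : nat) :
  admissible q t -> (forall n, closed (L n)) -> (forall n, L n.+1 `<=` L n) ->
  (forall m, (m0 <= m)%N -> exists x y, [/\ left_window x, right_window y,
     exists2 a, L m a & `|x - a| < (1 / 2) ^+ m, exists2 a, L m a & `|y - a| < (1 / 2) ^+ m &
     exists2 a, L m a & `|phi q t x y - a| < (1 / 2) ^+ m]) ->
  exists x y, [/\ left_window x, right_window y, (\bigcap_n L n) x, (\bigcap_n L n) y &
    (\bigcap_n L n) (phi q t x y)].
Proof.
move=> adm Lcl Ldec H.
have Lmn n m : (n <= m)%N -> L m `<=` L n.
  by move=> /subnK <-; elim: (m - n)%N => [//|d IH]; rewrite addSn; exact: subset_trans (Ldec _) IH.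
have /boolp.choice [p hp] : forall m, exists p : R * R, (m0 <= m)%N ->
   [/\ left_window p.1, right_window p.2,
     exists2 a, L m a & `|p.1 - a| < (1 / 2) ^+ m, exists2 a, L m a & `|p.2 - a| < (1 / 2) ^+ m &
     exists2 a, L m a & `|phi q t p.1 p.2 - a| < (1 / 2) ^+ m].
  move=> m; have [mm|mm] := leqP m0 m; last by exists (0, 0).
  by have [x [y h]] := H m mm; exists (x, y).
(* The windows are closed and disjoint, so a cluster point of the approximate patterns exists and is
   again a nondegenerate pair. *)
pose A : set (R * R) := `[1 / 8, 9 / 64]%classic `*` `[3 / 8, 25 / 64]%classic.
have cA : compact A by apply: compact_setX; exact: segment_compact.
have FA : (p @ \oo) A.
  exists m0 => // m /= mm; have [wl wr _ _ _] := hp m mm.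
  by split => /=; rewrite in_itv.
have [[x y] [[/= Ax Ay] cl]] := cA (p @ \oo) _ FA.
have wx : left_window x by move: Ax; rewrite /= in_itv.
have wy : right_window y by move: Ay; rewrite /= in_itv.
have near (e : R) (n : nat) : 0 < e -> exists m, [/\ (n <= m)%N, (m0 <= m)%N, (1 / 2) ^+ m < e,
    `|x - (p m).1| < e & `|y - (p m).2| < e].
  move=> e0; have h1 : `|1 / 2 : R| < 1 by rewrite ger0_norm; lra.
  have /cvgrPdist_lt /(_ _ e0) [N _ hN] := cvg_expr h1.
  have U : (p @ \oo) [set p m | m in [set m | (n <= m)%N /\ (m0 <= m)%N /\ (N <= m)%N]].
    exists (maxn n (maxn m0 N)) => // m /=; rewrite !geq_max => /and3P[? ? ?]; exists m => //.
  have [_ [[m [nm [m0m Nm]] <-] [/= b1 b2]]] := cl _ _ U (nbhsx_ballx (x, y) e e0).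
  exists m; split => //.
  by have := hN m Nm; rewrite /= sub0r normrN ger0_norm // exprn_ge0 // divr_ge0.
exists x, y; split => // n _; apply: closed_approx => // e e0.
- have [m [nm m0m hm b1 _]] := near (e / 2) n (divr_gt0 e0 (ltr0n _ 2)).
  have [_ _ [a La ha] _ _] := hp m m0m; exists a; first exact: Lmn nm _ La.
  rewrite -(subrKA (p m).1) [ltRHS]splitr; apply: (le_lt_trans (ler_normD _ _)).
  by rewrite ltrD // (lt_trans ha).
- have [m [nm m0m hm _ b2]] := near (e / 2) n (divr_gt0 e0 (ltr0n _ 2)).
  have [_ _ _ [a La ha] _] := hp m m0m; exists a; first exact: Lmn nm _ La.
  rewrite -(subrKA (p m).2) [ltRHS]splitr; apply: (le_lt_trans (ler_normD _ _)).
  by rewrite ltrD // (lt_trans ha).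
(* Moving the two arguments of [phi], with constant 9 each, and approximating once cost less than
   19/20 of [e]. *)
- have [m [nm m0m hm b1 b2]] := near (e / 20) n (divr_gt0 e0 (ltr0n _ 20)).
  have [wl wr _ _ [a La ha]] := hp m m0m; exists a; first exact: Lmn nm _ La.
  have d1 : `|phi q t x y - phi q t (p m).1 y| <= 9 * `|x - (p m).1|.
    have := @phi_shift_l R q t (p m).1 y (x - (p m).1) adm wl wy.
    rewrite (addrC (p m).1) subrK; apply; move: wx wl => /andP[? ?] /andP[? ?].
    by rewrite ler_norml; apply/andP; split; lra.
  have d2 : `|phi q t (p m).1 y - phi q t (p m).1 (p m).2| <= 9 * `|y - (p m).2|.
    have := @phi_shift_r R q t (p m).1 (p m).2 (y - (p m).2) adm wl wr.
    rewrite (addrC (p m).2) subrK; apply; move: wy wr => /andP[? ?] /andP[? ?].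
    by rewrite ler_norml; apply/andP; split; lra.
  rewrite -(subrKA (phi q t (p m).1 (p m).2)); apply: (le_lt_trans (ler_normD _ _)).
  rewrite -(subrKA (phi q t (p m).1 y)).
  have := ler_normD (phi q t x y - phi q t (p m).1 y) (phi q t (p m).1 y - phi q t (p m).1 (p m).2).
  lra.
Qed.

End Limit.

(** * Conclusion *)

Section Exponent.
Context {R : realType}.

(* [2 * 2^(-beta)] is the [P]-th root of [1 + tau]. *)
Lemma exponent_choice (tau : R) (P : nat) : 0 < tau < 1 -> (0 < P)%N ->
  exists beta : R, [/\ 0 < beta < 1, 1 <= 2 * 2 `^ (- beta) & (2 * 2 `^ (- beta)) ^+ P = 1 + tau].
Proof.
move=> /andP[t0 t1] P0.
have P0' : 0 < P%:R :> R by rewrite ltr0n.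
have ln2 : 0 < ln 2 :> R by rewrite ln_gt0 // ltr1n.
have l0 : 0 < ln (1 + tau) by rewrite ln_gt0 // ltrDl.
have l1 : ln (1 + tau) < ln 2 by rewrite ltr_ln ?posrE //; lra.
pose d := ln (1 + tau) / (P%:R * ln 2).
have d0 : 0 < d by rewrite divr_gt0 // mulr_gt0.
have d1 : d < 1.
  rewrite ltr_pdivrMr ?mulr_gt0 // mul1r; apply: (lt_le_trans l1).
  by rewrite ler_peMl ?(ltW ln2) // ler1n.
exists (1 - d).
have E : 2 * 2 `^ (- (1 - d)) = 2 `^ d :> R.
  by rewrite opprB powRD ?pnatr_eq0 ?implybT // powR_inv1 // mulrCA divff ?mulr1 ?pnatr_eq0.
rewrite E; split.
- by apply/andP; split; lra.
- by rewrite -[leLHS](powRr0 2) ler_powR ?ler1n // ltW.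
- rewrite -powR_mulrn ?powR_ge0 // -powRrM /d /powR pnatr_eq0 /=.
  rewrite (_ : _ * _ * _ = ln (1 + tau)) ?lnK ?posrE //; first lra.
  by field; rewrite !gt_eqF.
Qed.

End Exponent.

Section Assembly.
Context {R : realType}.

Lemma mollified_leq (n m : nat) (g : R) (f : nat -> R -> R) : (m <= n)%N ->
  mollified n g f -> mollified m g f.
Proof.
move=> mn [h1 h2 h3 h4]; split => //.
- by move=> k z km; apply: h2; exact: leq_trans mn.
- by move=> k z z' km; apply: h3; exact: leq_trans mn.
Qed.

Definition rescaled (k : nat) (i : int) (E : set R) : set R :=
  [set u | E ((u + i%:~R) / 2 ^+ k)].

Lemma closed_affine (a b : R) (C : set R) : closed C -> closed [set u | C (a * u + b)].
Proof.
move=> cC; apply: (@preimage_closed _ _ (fun u : R => a * u + b)) => // x _.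
by apply: cvgD; [apply: cvgM; [exact: cvg_cst | exact: cvg_id] | exact: cvg_cst].
Qed.

(** The value of a configuration scales like the inverse of a length, whence 2^k. The first and
    third points differ because t (y - x) is at least 75/64 while [q] is at least -1. *)
Lemma config_scaled (E : set R) (k : nat) (i : int) (q t x y : R) :
  admissible q t -> left_window x -> right_window y ->
  rescaled k i E x -> rescaled k i E y -> rescaled k i E (phi q t x y) ->
  config_set q E (t * 2 ^+ k).
Proof.
move=> [/andP[q1 q2] /andP[t1 t2]] /andP[x1 x2] /andP[y1 y2] Ex Ey Ez.
have p2 : 2 ^+ k != 0 :> R by rewrite expf_neq0 // pnatr_eq0.
have h0 : 15 / 64 <= y - x by lra.
have th : 5 * (15 / 64) <= t * (y - x) by apply: ler_pM => //; lra.
have iv : (2 ^+ k)^-1 != 0 :> R by rewrite invr_neq0.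
exists ((x + i%:~R) / 2 ^+ k), ((y + i%:~R) / 2 ^+ k), ((phi q t x y + i%:~R) / 2 ^+ k).
split => //; split.
- rewrite -subr_eq0 -mulrBl mulf_neq0 //; apply/eqP; lra.
- rewrite -subr_eq0 -mulrBl mulf_neq0 //.
  rewrite (_ : _ - _ = - ((y - x) * (q + t * (y - x)))); last by rewrite /phi; ring.
  by rewrite oppr_eq0 mulf_neq0 //; apply/eqP; lra.
- rewrite -!mulrBl.
  have -> : y + i%:~R - (x + i%:~R) = y - x by ring.
  have -> : phi q t x y + i%:~R - (x + i%:~R) = q * (y - x) + t * (y - x) ^+ 2 by rewrite /phi;
      ring.
  by field; apply/andP; split => //; apply/eqP; lra.
Qed.

(** The reflection changes the sign of z - x and of y - x, hence of the numerator but not of the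
    denominator. *)
Lemma config_scaled_mirror (E : set R) (k : nat) (i : int) (q t x y : R) :
  admissible q t -> left_window x -> right_window y ->
  rescaled k i E (1 - x) -> rescaled k i E (1 - y) -> rescaled k i E (1 - phi q t x y) ->
  config_set q E (- (t * 2 ^+ k)).
Proof.
move=> [/andP[q1 q2] /andP[t1 t2]] /andP[x1 x2] /andP[y1 y2] Ex Ey Ez.
have p2 : 2 ^+ k != 0 :> R by rewrite expf_neq0 // pnatr_eq0.
have h0 : 15 / 64 <= y - x by lra.
have th : 5 * (15 / 64) <= t * (y - x) by apply: ler_pM => //; lra.
have iv : (2 ^+ k)^-1 != 0 :> R by rewrite invr_neq0.
exists ((1 - x + i%:~R) / 2 ^+ k), ((1 - y + i%:~R) / 2 ^+ k), ((1 - phi q t x y + i%:~R) / 2 ^+ k).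
split => //; split.
- rewrite -subr_eq0 -mulrBl mulf_neq0 //; apply/eqP; lra.
- rewrite -subr_eq0 -mulrBl mulf_neq0 //.
  rewrite (_ : _ - _ = (y - x) * (q + t * (y - x))); last by rewrite /phi; ring.
  by rewrite mulf_neq0 //; apply/eqP; lra.
- rewrite -!mulrBl.
  have -> : 1 - y + i%:~R - (1 - x + i%:~R) = - (y - x) by ring.
  have -> : 1 - phi q t x y + i%:~R - (1 - x + i%:~R) = - (q * (y - x) +
      t * (y - x) ^+ 2) by rewrite /phi; ring.
  by field; apply/andP; split => //; apply/eqP; lra.
Qed.

(** The cell [(k, i)] is found from [E] alone, so that one scale serves all [q] and [t] and both
    signs. *)
Lemma patterns_in_rescaled : exists beta : R, 0 < beta < 1 /\
  forall E : set R, suslin E -> (beta%:E < hausdorff_dim E)%E ->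
  exists k i, forall q t, admissible q t ->
   (exists x y, [/\ left_window x, right_window y, rescaled k i E x, rescaled k i E y &
      rescaled k i E (phi q t x y)]) /\
   (exists x y, [/\ left_window x, right_window y, rescaled k i E (1 - x), rescaled k i E (1 - y) &
      rescaled k i E (1 - phi q t x y)]).
Proof.
have [m0 [m00 core]] := @mollified_pattern R.
(* One level finer than the scale 48 m0 of the lower bound, as in [atom_density_ge]. *)
have [N0 N0E] : exists N0, N0 = (48 * m0).+1 by eexists.
have N03 : (3 <= N0)%N by lia.
(* [P] is at least 144 for the growth condition in [core], and at least [N0] so that (2 w)^N0 is at
   most 1 + tau. *)
have [P [P0 P144 PN0]] : exists P, [/\ (0 < P)%N, (144 <= P)%N & (N0 <= P)%N].
  by exists (144 + N0)%N; split; lia.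
have [G GE] : exists G : R, G = 2 ^+ N0 by eexists.
pose tau := 1 / (4 * G).
have G8 : 8 <= G.
  rewrite GE (_ : 8 = 2 ^+ 3 :> R); last by rewrite -natrX.
  by apply: ler_weXn2l N03; rewrite ler1n.
have G0 : 0 < G by lra.
have tauG : tau * G = 1 / 4 by rewrite /tau; field; rewrite gt_eqF.
have tau0 : 0 < tau by rewrite divr_gt0 // mulr_gt0.
have tau8 : tau <= 1 / 8.
  by rewrite /tau ler_pdivrMr ?mulr_gt0 //; lra.
have [beta [b01 g1 gP]] := @exponent_choice R tau P ltac:(lra) P0.
set w := 2 `^ (- beta) in g1 gP.
have w0 : 0 < w by exact: powR_gt0.
exists beta; split => // E sE dimE.
pose c := 1 - tau.
have c01 : 0 < c < 1 by rewrite /c; lra.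
have b0 : 0 < beta by case/andP: b01.
have [[k i] /= dens] := content_density w0 c01 (content_neq0 b0 dimE).
have [K [Kcl Kdec KE Kc]] := capacitable w0 sE dens.
have g144 : (2 * w) ^+ 144 <= 9 / 8.
  apply: (@le_trans _ _ ((2 * w) ^+ P)); last by rewrite gP; lra.
  exact: ler_weXn2l g1 _ _ P144.
have gN0 : (2 * w) ^+ N0 <= 1 + tau.
  by rewrite -gP; exact: ler_weXn2l g1 _ _ PN0.
(* The other [G - 1] cells hold at most (G - 1) (1 + tau) / G = (1 - 4 tau) (1 + tau), which leaves
   2 tau + 4 tau^2 of the mass 1 - tau. The required share 1 / (2 G) is 2 tau: this dictates the
   value of [tau]. *)
have cell_bound : 1 / (2 * G) <= c - (G - 1) * w ^+ N0.
  have wN : w ^+ N0 * G <= 1 + tau by rewrite GE -exprMn mulrC.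
  have e1 : 1 / (2 * G) = 2 * tau by rewrite /tau; field; rewrite gt_eqF.
  have h : w ^+ N0 <= 1 / G * (1 + tau).
    by rewrite mulrC mulrA mulr1 ler_pdivlMr.
  have e2 : 1 / G = 4 * tau by rewrite /tau; field; rewrite gt_eqF.
  have : (G - 1) * w ^+ N0 <= (G - 1) * (4 * tau * (1 + tau)).
    by apply: ler_wpM2l; [lra | rewrite -e2].
  have -> : (G - 1) * (4 * tau * (1 + tau)) = (tau * G - tau) * 4 * (1 + tau) by ring.
  rewrite e1 tauG /c; have : 0 <= tau ^+ 2 by exact: sqr_ge0.
  nra.
have level q t m : admissible q t -> (m0 <= m)%N ->
  (exists x y, [/\ left_window x, right_window y,
     exists2 a, rescaled k i (K m) a & `|x - a| < (1 / 2) ^+ m,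
     exists2 a, rescaled k i (K m) a & `|y - a| < (1 / 2) ^+ m &
     exists2 a, rescaled k i (K m) a & `|phi q t x y - a| < (1 / 2) ^+ m]) /\
  (exists x y, [/\ left_window x, right_window y,
     exists2 a, rescaled k i (K m) (1 - a) & `|x - a| < (1 / 2) ^+ m,
     exists2 a, rescaled k i (K m) (1 - a) & `|y - a| < (1 / 2) ^+ m &
     exists2 a, rescaled k i (K m) (1 - a) & `|phi q t x y - a| < (1 / 2) ^+ m]).
  move=> adm mm.
  have c0 : 0 <= c by case/andP: c01 => /ltW.
  have [s [hs tot cm]] := frostman_atoms_rescaled w0 (48 * m + 1) c0 (ltW (Kc m)).
  have s0 a : a \in s -> 0 <= a.2 by move=> /hs[].
  have moll0 := atom_density_mollified (ltW w0) s0 cm.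
  have moll : mollified (48 * m) (2 * w) (atom_density s).
    exact: mollified_leq (leq_addr _ _) moll0.
  have m0m : ((48 * m0).+1 <= 48 * m + 1)%N by rewrite addn1 ltnS leq_mul2l mm orbT.
  have mm48 : (m <= 48 * m)%N by rewrite leq_pmull.
  have big z : 0 < z < 1 -> 1 / 8 <= atom_density s (48 * m0) z.
    move=> /andP[z0 z1]; apply: (atom_density_ge (ltW w0) s0 cm m0m (c := c)).
    - by move=> a /hs[].
    - by rewrite tot.
    - by rewrite (ltW z0).
    - by rewrite -N0E -GE.
  have near z : 0 < atom_density s (48 * m) z ->
      exists2 a, rescaled k i (K m) a & `|z - a| < (1 / 2) ^+ m.
    move=> /atom_density_gt0[a /hs[Ka _ _] za]; exists a.1 => //.
    apply: (lt_le_trans za); apply: (ler_wiXn2l _ _ mm48); first by rewrite divr_ge0.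
    by rewrite ler_pdivrMr // mul1r ler1n.
  split.
    have [x [y [wx wy /near fx /near fy /near fz]]] := core m (2 * w) q t _ mm g1 g144 adm moll big.
    by exists x, y.
  have big' z : 0 < z < 1 -> 1 / 8 <= atom_density s (48 * m0) (1 - z).
    by move=> /andP[? ?]; apply: big; apply/andP; split; lra.
  have [x [y [wx wy fx fy fz]]] := core m (2 * w) q t _ mm g1 g144 adm (mollified_mirror moll) big'.
  have near' z : 0 < atom_density s (48 * m) (1 - z) ->
      exists2 a, rescaled k i (K m) (1 - a) & `|z - a| < (1 / 2) ^+ m.
    move=> /near[a Ka za]; exists (1 - a); first by rewrite opprB addrC subrK.
    by rewrite -normrN (_ : - (z - (1 - a)) = 1 - z - a) //; ring.
  by exists x, y; split => //; exact: near'.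
exists k, i => q t adm; split.
  have [| | |x [y [wx wy Lx Ly Lz]]] := @limit_pattern R (fun m => rescaled k i (K m)) q t m0 adm.
  - move=> n; rewrite (_ : rescaled k i (K n) = [set u | K n ((2 ^+ k)^-1 * u + i%:~R / 2 ^+ k)]).
      exact: closed_affine.
    by apply/seteqP; split => u; rewrite /rescaled /= mulrDl (mulrC u).
  - by move=> n u; exact: Kdec.
  - by move=> m mm; have [] := level q t m adm mm.
  exists x, y; split => //; apply: KE => n _; [exact: Lx | exact: Ly | exact: Lz].
have [| | |x [y [wx wy Lx Ly Lz]]] := @limit_pattern R (fun m => [set u | rescaled k i (K m) (1
    - u)]) q t m0 adm.
- move=> n; rewrite (_ : mkset _ = [set u | K n (- (2 ^+ k)^-1 * u + (1 + i%:~R) / 2 ^+ k)]).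
    exact: closed_affine.
  apply/seteqP; split => u; rewrite /rescaled /=;
    by rewrite (_ : (1 - u + i%:~R) / 2 ^+ k = - (2 ^+ k)^-1 * u + (1 + i%:~R) / 2 ^+ k); [|ring].
- by move=> n u; exact: Kdec.
- by move=> m mm; have [] := level q t m adm mm.
exists x, y; split => //; apply: KE => n _; [exact: Lx | exact: Ly | exact: Lz].
Qed.

End Assembly.

Theorem corollary1p4 (R : realType) (q0 : R) (hq0 : 0 <= q0 < 1) :
  exists beta : R, 0 < beta < 1 /\
    forall E : set R,
      measurable (E : set (measurableTypeR R)) ->
      (beta%:E < hausdorff_dim E)%E ->
      exists a0 a1 : R, 0 < a0 < a1 /\
        forall q : R, q \in `[- q0, q0] ->
          `[- a1, - a0] `|` `[a0, a1] `<=` config_set q E.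
Proof.
have [beta [b01 main]] := @patterns_in_rescaled R.
exists beta; split => // E mE dimE.
have [k [i pat]] := main E (suslin_measurable mE) dimE.
have p2 : 0 < 2 ^+ k :> R by rewrite exprn_gt0.
exists (5 * 2 ^+ k), (51 / 10 * 2 ^+ k); split.
  by rewrite mulr_gt0 //= ltr_pM2r //; lra.
move=> q; rewrite in_itv /= => /andP[qa qb] a.
have adm t : 5 * 2 ^+ k <= t <= 51 / 10 * 2 ^+ k -> admissible q (t / 2 ^+ k).
  move=> /andP[ta tb]; split; first by apply/andP; split; lra.
  by rewrite ler_pdivlMr // ler_pdivrMr // ta.
have tK (t : R) : t / 2 ^+ k * 2 ^+ k = t by rewrite divfK // gt_eqF.
case; rewrite /= in_itv /= => /andP[ha hb].
  have at_adm := adm (- a) ltac:(apply/andP; split; lra).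
  have [_ [x [y [wx wy Ex Ey Ez]]]] := pat q _ at_adm.
  by have := config_scaled_mirror at_adm wx wy Ex Ey Ez; rewrite tK opprK.
have at_adm := adm a ltac:(apply/andP; split; lra).
have [[x [y [wx wy Ex Ey Ez]]] _] := pat q _ at_adm.
by have := config_scaled at_adm wx wy Ex Ey Ez; rewrite tK.
Qed.
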